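(* Let $G$ be a graph. If $c_{1}(G-X)+\frac{1}{3}c_{3}(G-X)+\frac{1}{3}c_{5}(G-X)\leq \frac{2}{3}|X|$ for all $X\subseteq V(G)$, then $G$ has a $\{P_{2},P_{7}\}$-factor.
   Context: All graphs are finite and simple. $P_n$ denotes the path with $n$ vertices. For a graph $H$ and $i\ge 1$, $c_i(H)$ denotes the number of (connected) components $C$ of $H$ with $|V(C)|=i$. $G-X$ is the graph obtained from $G$ by deleting the vertices in $X$. For a set $\mathcal{H}$ of connected graphs, an $\mathcal{H}$-factor of $G$ is a spanning subgraph $F$ of $G$ such that every component of $F$ is isomorphic to a graph in $\mathcal{H}$. *)

(* Defs.v *)
From HB Require Import structures.
From mathcomp Require Import all_boot.

Set Implicit Arguments.
Unset Strict Implicit.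
Unset Printing Implicit Defensive.

Record sgraph := SGraph {
  vertex :> finType;
  adj : rel vertex;
  adj_sym : symmetric adj;
  adj_irrefl : irreflexive adj }.

Definition isomorphic (G H : sgraph) : Prop :=
  exists2 f : G -> H, bijective f & forall x y, adj (f x) (f y) = adj x y.

Section Induced.
Variables (G : sgraph) (A : {set G}).

Definition induced_adj : rel {x : G | x \in A} :=
  fun x y => adj (val x) (val y).

Lemma induced_sym : symmetric induced_adj.
Proof. by move=> x y; apply: adj_sym. Qed.

Lemma induced_irrefl : irreflexive induced_adj.
Proof. by move=> x; apply: adj_irrefl. Qed.

Definition induced : sgraph := SGraph induced_sym induced_irrefl.
End Induced.

(* G - X *)
Definition delete (G : sgraph) (X : {set G}) : sgraph := induced (~: X).

(* Vertex sets of the connected components; [connect] is the reflexive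
   transitive closure of [adj]. *)
Definition components (G : sgraph) : {set {set G}} :=
  equivalence_partition (connect (@adj G)) [set: G].

(* c_i(G) *)
Definition ncomp (i : nat) (G : sgraph) : nat :=
  #|[set C in components G | #|C| == i]|.

Section PathGraph.
Variable n : nat.

Definition path_adj : rel 'I_n := fun i j => (i.+1 == j) || (j.+1 == i).

Lemma path_sym : symmetric path_adj.
Proof. by move=> i j; rewrite /path_adj orbC. Qed.

Lemma path_irrefl : irreflexive path_adj.
Proof. by move=> i; rewrite /path_adj orbb eqn_leq ltnn. Qed.

(* P_n, the path with n vertices *)
Definition path_graph : sgraph := SGraph path_sym path_irrefl.
End PathGraph.

Record spanning_subgraph (G : sgraph) := SpanningSubgraph {
  sub_adj : rel G;
  sub_adj_sym : symmetric sub_adj;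
  sub_adj_sub : subrel sub_adj (@adj G) }.

Lemma sub_adj_irrefl (G : sgraph) (F : spanning_subgraph G) :
  irreflexive (sub_adj F).
Proof.
by move=> x; apply/negP => /(@sub_adj_sub _ F); rewrite adj_irrefl.
Qed.

Coercion spanning_graph (G : sgraph) (F : spanning_subgraph G) : sgraph :=
  SGraph (@sub_adj_sym _ F) (@sub_adj_irrefl _ F).

(* A component of F, as a graph, is the subgraph of F (not of G) induced by its
   vertex set. *)
Definition is_factor (HH : sgraph -> Prop) (G : sgraph)
    (F : spanning_subgraph G) : Prop :=
  forall C : {set F}, C \in components F ->
    exists2 K : sgraph, HH K & isomorphic (induced C) K.

Definition has_factor (HH : sgraph -> Prop) (G : sgraph) : Prop :=
  exists F : spanning_subgraph G, is_factor HH F.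

(* Main.v *)
Require Import Defs.
From mathcomp Require Import all_boot all_order all_algebra.
From mathcomp Require Import zify lra.

(** Take S maximal among the sets maximising the number of odd components of
    G - S minus |S|: every component of G - S is factor-critical and S can be
    matched into distinct components.
    An alternating-path analysis shows that a factor-critical graph of order at
    least 7 either splits into copies of P2 and P7, or is a windmill (triangles
    sharing one vertex). Call the components of order 1, 3, 5 and the windmills
    bad: inside each of them the weight 3 c_1 + c_3 + c_5 can be made to exceed
    2 |X| by at least 3 (order 1) or 1 (the others). Hence by Hall's theorem
    every vertex of S can distribute 2 units among adjacent bad components so
    that isolated vertices receive 3 units and the others receive 1. From such
    a distribution one extracts disjoint links a - D, D - a - D' and
    D - a - v - b - D' (a, b in S, v an isolated vertex, D, D' of order at least
    3) covering all bad components; alternating along the matching of S makes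
    them cover S as well. Each link has a {P2, P7}-tiling because in D one can
    leave a path of order 3 ending at any prescribed vertex and match the
    rest. *)

Set Implicit Arguments.
Unset Strict Implicit.
Unset Printing Implicit Defensive.

(** * Hall's marriage theorem *)

Lemma bigcup_setDl (T U : finType) (e : T -> {set U}) (C : {set T}) (N : {set U}) :
  \bigcup_(x in C) (e x :\: N) = (\bigcup_(x in C) e x) :\: N.
Proof.
apply/setP=> u; rewrite inE; apply/bigcupP/andP => [[x xC]|[uN /bigcupP [x xC ux]]].
  by rewrite inE => /andP [uN ux]; split=> //; apply/bigcupP; exists x.
by exists x => //; rewrite inE uN.
Qed.

(** Induction on [#|A|]. If a nonempty proper subset [B] is tight, it uses up the union [N] of its
    sets, and Hall's condition survives on [A :\: B] after deleting [N]. Otherwise every nonempty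
    proper subset has an element to spare, so any [x] may take any [u] in [e x]. The value [u0]
    provides a function when [A] is empty. *)
Lemma Hall_marriage (T U : finType) (u0 : U) (e : T -> {set U}) (A : {set T}) :
  (forall B : {set T}, B \subset A -> #|B| <= #|\bigcup_(x in B) e x|) ->
  exists2 f : T -> U, {in A &, injective f} & {in A, forall x, f x \in e x}.
Proof.
have [n] := ubnP #|A|; elim: n e A => // n IHn e A leAn hallA.
have [->|[x xA]] := set_0Vmem A; first by exists (fun=> u0) => ?; rewrite inE.
case: (boolP [exists B : {set T}, [&& B \proper A, B != set0 &
    #|\bigcup_(y in B) e y| == #|B|]]).
  case/existsP => B /and3P [/[dup] /properP [sBA _] prB /set0Pn [y yB] /eqP tightB].
  have ltBA := proper_card prB.
  have B_gt0 : 0 < #|B| by rewrite card_gt0; apply/set0Pn; exists y.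
  have [||f fI fe] := IHn e B; first by lia.
    by move=> C sCB; apply: hallA; apply: subset_trans sBA.
  set N := \bigcup_(y in B) e y in tightB.
  have [||g gI ge] := IHn (fun y => e y :\: N) (A :\: B).
  - by have := cardsID B A; rewrite (setIidPr sBA); lia.
  - move=> C; rewrite subsetD => /andP [sCA dCB].
    have := hallA (B :|: C); rewrite subUset sBA sCA bigcup_setU => /(_ isT).
    have -> : \bigcup_(z in C) (e z :\: N) = (\bigcup_(z in C) e z) :\: N.
      by rewrite bigcup_setDl.
    rewrite cardsU (_ : B :&: C = set0); last first.
      by apply/eqP; rewrite setI_eq0 disjoint_sym.
    by rewrite -/N cards0 cardsU cardsD setIC tightB; lia.
  have feN z : z \in B -> f z \in N by move=> zB; apply/bigcupP; exists z; rewrite ?fe.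
  exists (fun z => if z \in B then f z else g z) => [z t zA tA|z zA].
    case: ifPn => zB; case: ifPn => tB.
    + exact: fI.
    + by move=> E; have := ge t; rewrite !inE tB tA -E feN // => /(_ isT).
    + by move=> E; have := ge z; rewrite !inE zB zA E feN // => /(_ isT).
    + by apply: gI; rewrite inE ?zB ?tB.
  case: ifPn => zB; first exact: fe.
  by have := ge z; rewrite !inE zB zA => /(_ isT) /andP [].
move/existsPn => notight.
have : 0 < #|e x| by have := hallA [set x]; rewrite sub1set xA big_set1 cards1 => /(_ isT).
rewrite card_gt0 => /set0Pn [u ux].
have [||g gI ge] := IHn (fun y => e y :\ u) (A :\ x).
- by have := cardsD1 x A; rewrite xA; lia.
- move=> C sC; have [->|C0] := eqVneq C set0; first by rewrite cards0.
  have prC : C \proper A.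
    by apply: sub_proper_trans sC _; apply: properD1.
  have := notight C; rewrite prC C0 /= => neC.
  have := hallA C (proper_sub prC).
  have -> : \bigcup_(z in C) (e z :\ u) = (\bigcup_(z in C) e z) :\ u.
    by rewrite bigcup_setDl.
  move: neC; rewrite (cardsD1 u (\bigcup_(z in C) e z)).
  by case: (u \in _) => /=; lia.
exists (fun z => if z == x then u else g z) => [z t zA tA|z zA].
  case: eqVneq => [->|zx]; case: eqVneq => [->|tx] //.
  - by move=> E; have := ge t; rewrite !inE tx tA -E eqxx => /(_ isT).
  - by move=> E; have := ge z; rewrite !inE zx zA E eqxx => /(_ isT).
  - by apply: gI; rewrite !inE ?zx ?tx.
case: eqVneq => [->//|zx].
by have := ge z; rewrite !inE zx zA => /(_ isT) /andP [].
Qed.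

(** * Connected components of induced subgraphs *)

Section Components.
Variable G : sgraph.
Implicit Types (U W C D S X : {set G}) (x y : G).

(** Components of induced subgraphs are kept as subsets of [G] by restricting the relation, so that
    deletions do not change the vertex type. *)
Definition adj_in U : rel G := fun x y => [&& x \in U, y \in U & adj x y].

Definition comps U : {set {set G}} :=
  equivalence_partition (connect (adj_in U)) U.

Lemma adj_in_csym U : connect_sym (adj_in U).
Proof. by apply: sym_connect_sym => x y; rewrite /adj_in adj_sym andbCA. Qed.

Lemma comps_partition U : partition (comps U) U.
Proof.
apply: equivalence_partitionP => x y z _ _ _; split; first exact: connect0.
by move=> /(same_connect (@adj_in_csym U)).
Qed.

Lemma comps_sub U C : C \in comps U -> C \subset U.
Proof.
move=> CU; rewrite -(cover_partition (comps_partition U)).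
exact: (bigcup_sup C).
Qed.

Lemma comps_neq0 U C : C \in comps U -> C != set0.
Proof.
by case/and3P: (comps_partition U) => _ _ n0 CU; apply: contraNneq n0 => <-.
Qed.

Lemma comps_eq U C D x : C \in comps U -> D \in comps U ->
  x \in C -> x \in D -> C = D.
Proof.
case/and3P: (comps_partition U) => _ tI _ CU DU xC xD.
by rewrite -(def_pblock tI CU xC) -(def_pblock tI DU xD).
Qed.

Lemma comps_cover U x : x \in U -> exists2 C, C \in comps U & x \in C.
Proof.
rewrite -{1}(cover_partition (comps_partition U)) => /bigcupP [C CU xC].
by exists C.
Qed.

(** A path of [U] that starts in [W] never leaves [W], so reachability from a point of [W] is the
    same in both sets. *)
Lemma sub_comps U W : W \subset U ->
  (forall x y, x \in W -> y \in U -> adj x y -> y \in W) ->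
  comps W \subset comps U.
Proof.
move=> /subsetP sWU clW; apply/subsetP=> _ /imsetP [x xW ->].
apply/imsetP; exists x; first exact: sWU.
apply/setP=> y; rewrite !inE.
have closedW z : connect (adj_in U) x z ->
    (z \in W) && connect (adj_in W) x z.
  case/connectP=> p; elim: p x xW => [|t p IHp] x xW /=.
    by move=> _ ->; rewrite xW connect0.
  case/andP=> /and3P [_ tU xt] pth E.
  have tW := clW _ _ xW tU xt.
  have /andP [-> tz] := IHp _ tW pth E.
  by apply: connect_trans tz; apply: connect1; rewrite /adj_in xW tW.
apply/andP/andP => [[yW xy]|[_ /closedW /andP []]] //.
split; first exact: sWU.
apply: connect_sub xy => a b /and3P [aW bW ab].
by apply: connect1; rewrite /adj_in !sWU.
Qed.

Lemma comps_closed U C x y : C \in comps U -> x \in C -> y \in U ->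
  adj x y -> y \in C.
Proof.
case/imsetP=> z zU ->; rewrite !inE => /andP [xU zx] yU xy.
rewrite yU; apply: connect_trans zx _; apply: connect1.
by rewrite /adj_in xU yU.
Qed.

(** Membership [C \in comps C] is the form in which connectedness of a vertex set is expressed
    below. *)
Lemma comps_self U C : C \in comps U -> C \in comps C.
Proof.
move=> CU; have /set0Pn [x xC] := comps_neq0 CU.
have [D DC xD] := comps_cover xC.
suff eDC : D = C by rewrite -{1}eDC.
apply: (comps_eq _ CU xD xC); apply: (subsetP _ _ DC).
by apply: (sub_comps (comps_sub CU)) => y z; apply: comps_closed.
Qed.

Lemma mem_comps_sub U W C : C \in comps U -> C \subset W ->
  (forall x y, x \in C -> y \in W -> adj x y -> y \in C) -> C \in comps W.
Proof. by move=> /comps_self + sCW clC; apply/subsetP/sub_comps. Qed.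

Lemma comps1 x : [set x] \in comps [set x].
Proof.
have [C CU xC] := comps_cover (set11 x).
suff E : C = [set x] by rewrite -{1}E.
by apply/eqP; rewrite eqEsubset comps_sub // sub1set.
Qed.

End Components.

(** * Matchings and factor-critical graphs *)

(** Generic in [P] because both matchings and tilings are glued over disjoint unions. *)
Lemma bigcup_disjoint_ind (T I : finType) (P : {set T} -> Prop)
    (F : I -> {set T}) (A : {set I}) :
  P set0 -> (forall B C : {set T}, [disjoint B & C] -> P B -> P C -> P (B :|: C)) ->
  (forall i, i \in A -> P (F i)) ->
  {in A &, forall i j, i != j -> [disjoint F i & F j]} ->
  P (\bigcup_(i in A) F i).
Proof.
move=> P0 PU; have [n] := ubnP #|A|; elim: n A => // n IHn A leAn PF dF.
have [->|[i iA]] := set_0Vmem A; first by rewrite big_set0.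
rewrite (big_setD1 i) //=; apply: PU; last 2 first.
- exact: PF.
- apply: IHn => [|j /setD1P [_ /PF //]|j k /setD1P [_ jA] /setD1P [_ kA]].
    by have := cardsD1 i A; rewrite iA; lia.
  exact: dF.
rewrite -setI_eq0 big_distrr /=; apply/eqP/big1 => j /setD1P [ji jA].
by apply/eqP; rewrite setI_eq0 dF // eq_sym.
Qed.

Section Matchings.
Variable G : sgraph.
Implicit Types (U W C D S X : {set G}) (x y v : G) (M : G -> G).

(** A perfect matching of the subgraph induced on [U], as an involution; the values of [M] outside
    [U] are arbitrary. *)
Definition matched M U :=
  forall x, x \in U -> [/\ M x \in U, adj x (M x) & M (M x) = x].

Definition matchable U := exists M, matched M U.

Definition factor_critical D := forall v, v \in D -> matchable (D :\ v).

(** [Y] takes from each edge of the matching the end of smaller rank. *)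
Lemma matched_half M U : matched M U ->
  exists Y : {set G}, [/\ [disjoint Y & M @: Y], Y :|: M @: Y = U & #|U| = #|Y|.*2].
Proof.
move=> MU; pose Y := [set x in U | enum_rank x < enum_rank (M x)].
have sYU x : x \in Y -> x \in U by rewrite inE => /andP [].
have injM : {in Y &, injective M}.
  by move=> x y /sYU /MU [_ _ {2}<-] /sYU /MU [_ _ {2}<-] ->.
have dY : [disjoint Y & M @: Y].
  apply/pred0P => y /=; apply/negP => /andP [yY /imsetP [x xY E]].
  move: xY yY; rewrite !inE E => /andP [/MU [_ _ Mx] lt1] /andP [_].
  by rewrite Mx ltnNge ltnW.
have defU : Y :|: M @: Y = U.
  apply/setP => x; rewrite inE; apply/orP/idP => [[/sYU //|]|xU].
    by case/imsetP=> y /sYU /MU [MyU _ _] ->.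
  have [MxU ax MMx] := MU x xU.
  case: (ltngtP (enum_rank x) (enum_rank (M x))) => [lt|gt|E].
  - by left; rewrite inE xU.
  - by right; apply/imsetP; exists (M x); rewrite // inE MxU MMx.
  - by move: ax; rewrite -(enum_rank_inj (val_inj E)) adj_irrefl.
exists Y; split=> //; rewrite -defU cardsU (_ : _ :&: _ = set0).
  by rewrite cards0 card_in_imset // subn0 addnn.
by apply/eqP; rewrite setI_eq0.
Qed.

Lemma matchable_even U : matchable U -> ~~ odd #|U|.
Proof. by case=> M /matched_half [Y [_ _ ->]]; rewrite odd_double. Qed.

Lemma factor_critical_odd D : D != set0 -> factor_critical D -> odd #|D|.
Proof.
case/set0Pn=> x xD fcD; have := matchable_even (fcD x xD).
by rewrite (cardsD1 x D) xD /= => ->.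
Qed.

Lemma matchable0 : matchable set0.
Proof. by exists id => x; rewrite inE. Qed.

Lemma matchableU U W : [disjoint U & W] -> matchable U -> matchable W ->
  matchable (U :|: W).
Proof.
move=> dUW [M MU] [N NW]; exists (fun x => if x \in U then M x else N x).
move=> x; rewrite inE; case: ifPn => [xU _|xU /= xW].
  by have [MxU ax Mx] := MU x xU; rewrite inE MxU.
have [NxW ax Nx] := NW x xW.
by rewrite inE NxW orbT (disjointFl dUW NxW).
Qed.

Lemma matched_sub M U W : matched M U -> W \subset U ->
  (forall x, x \in W -> M x \in W) -> matched M W.
Proof.
by move=> MU /subsetP sWU clW x xW; have [_ ? ?] := MU x (sWU x xW); split; rewrite ?clW.
Qed.

Lemma matchable2 x y : adj x y -> matchable [set x; y].
Proof.
move=> xy; have nxy : x != y by apply: contraTneq xy => ->; rewrite adj_irrefl.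
exists (fun z => if z == x then y else x) => z /set2P [->|->].
  by rewrite eqxx eq_sym (negPf nxy) !inE eqxx orbT.
by rewrite eq_sym (negPf nxy) eqxx !inE eqxx adj_sym.
Qed.

Definition nbr x D := [exists y in D, adj x y].

Lemma factor_critical_matchable x D : x \notin D -> nbr x D ->
  factor_critical D -> matchable (x |: D).
Proof.
move=> xD /exists_inP [y yD xy] fcD.
rewrite -(setD1K yD) setUA.
apply: (matchableU _ (matchable2 xy) (fcD y yD)).
rewrite -setI_eq0; apply/eqP/setP=> z; rewrite !inE.
by case: (eqVneq z x) => [->|_]; rewrite ?(negPf xD) ?andbF //=; case: eqP.
Qed.

Definition odd_comps U := [set C in comps U | odd #|C|].

Lemma odd_card_comps U : (forall C, C \in comps U -> odd #|C|) ->
  odd #|U| = odd #|comps U|.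
Proof.
move=> oddC; rewrite (card_partition (comps_partition U)) -sum1_card.
by rewrite !(big_morph odd oddD (erefl _)); apply: eq_bigr => C /oddC ->.
Qed.

(** A decomposition of Gallai-Edmonds type, from an [S] of maximal Berge deficiency. For [c] in a
    component [C], induction gives a barrier [S'] of [C :\ c]; moving [c] and [S'] into [S]
    contradicts the choice of [S] unless [m] maps [S'] onto all components left in [C]. The final
    [m] comes from Hall's theorem, as a violating subset could be dropped from [S] with profit. *)
Lemma barrier_exists U : exists S (m : G -> {set G}),
  [/\ S \subset U, forall C, C \in comps (U :\: S) -> factor_critical C,
      {in S &, injective m} &
      forall x, x \in S -> m x \in comps (U :\: S) /\ nbr x (m x)].
Proof.
have [n] := ubnP #|U|; elim: n U => // n IHn U leUn.
(* The Berge deficiency q - |S| shifted by |U|, with ties broken by |S|. *)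
pose f S := (#|odd_comps (U :\: S)| + #|U :\: S|) * #|G|.+1 + #|S|.
have [S sSU maxS] : exists2 S : {set G}, S \subset U & forall S', S' \subset U -> f S' <= f S.
  by case: (@arg_maxnP _ set0 (fun S => S \subset U) f); rewrite ?sub0set // => S; exists S.
have maxq S' : S' \subset U ->
    #|odd_comps (U :\: S')| + #|U :\: S'| <= #|odd_comps (U :\: S)| + #|U :\: S|.
  move=> /maxS; rewrite /f => le_f; rewrite -ltnS -(ltn_pmul2r (ltn0Sn #|G|)) mulSn.
  have := max_card S; lia.
have maxs S' : S' \subset U -> #|S| < #|S'| ->
    #|odd_comps (U :\: S')| + #|U :\: S'| < #|odd_comps (U :\: S)| + #|U :\: S|.
  move=> sS'U ltSS'; rewrite ltn_neqAle maxq // andbT; apply: contraTneq ltSS' => E.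
  by have := maxS _ sS'U; rewrite /f E leq_add2l -leqNgt.
have fcS C : C \in comps (U :\: S) -> factor_critical C.
  move=> CU c cC; have sCU := comps_sub CU.
  have [cU cS] : c \in U /\ c \notin S.
    by have := subsetP sCU c cC; rewrite inE => /andP [].
  have ltC : #|C :\ c| < n.
    have := cardsD1 c C; rewrite cC.
    have := subset_leq_card sCU; have := subset_leq_card (subsetDl U S); lia.
  have [S' [m [sS'C fc' m_inj mP]]] := IHn _ ltC.
  set R := C :\ c :\: S' in fc' mP.
  have sRC : R \subset C by exact: (subset_trans (subsetDl _ _) (subsetDl _ _)).
  have dS'S : [disjoint S' & S].
    rewrite disjoint_subset; apply/subsetP => x /(subsetP sS'C).
    by rewrite !inE => /andP [_ /(subsetP sCU)]; rewrite inE => /andP [].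
  have cS' : c \notin S' by apply: contraT => /negPn /(subsetP sS'C); rewrite !inE eqxx.
  set S2 := S :|: (c |: S').
  have S2U : S2 \subset U.
    rewrite !subUset sSU sub1set cU /=; apply: subset_trans sS'C _.
    by rewrite (subset_trans (subsetDl _ _)) // (subset_trans sCU) // subsetDl.
  have cardS2 : #|S2| = #|S| + #|S'|.+1.
    rewrite cardsU cardsU1 cS' (_ : _ :&: _ = set0) ?cards0 ?subn0 //.
    apply/setP=> x; rewrite !inE; case: (boolP (x \in S)) => //= xS.
    by rewrite (disjointFl dS'S xS) orbF; apply: contraNF cS => /eqP <-.
  have memS2 x : x \in U :\: S2 = [&& x \in U :\: S, x != c & x \notin S'].
    by rewrite !inE !negb_or; do !case: (x \in _); rewrite ?andbF ?andbT.
  have RUS2 x : x \in R -> x \in U :\: S2.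
    move=> xR; rewrite memS2 (subsetP sCU x (subsetP sRC x xR)) /=.
    by move: xR; rewrite !inE => /and3P [-> ->].
  have sub1 : comps R \subset odd_comps (U :\: S2).
    apply/subsetP=> E ER; have sER := comps_sub ER.
    rewrite inE (factor_critical_odd (comps_neq0 ER) (fc' _ ER)) andbT.
    apply: (mem_comps_sub ER) => [|x y xE]; first by apply/subsetP=> x /(subsetP sER)/RUS2.
    rewrite memS2 => /and3P [yU yc yS'] xy.
    apply: (comps_closed ER xE _ xy); rewrite !inE yc yS'.
    exact: (comps_closed CU (subsetP sRC x (subsetP sER x xE)) yU xy).
  have sub2 : odd_comps (U :\: S) :\ C \subset odd_comps (U :\: S2).
    apply/subsetP=> E; rewrite !inE => /and3P [neEC EU ->]; rewrite andbT.
    apply: (mem_comps_sub EU) => [|x y xE].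
      apply/subsetP=> x xE; rewrite memS2 (subsetP (comps_sub EU)) //=.
      have xC : x \notin C by apply: contraNN neEC => /(comps_eq EU CU xE) ->.
      apply/andP; split; first by apply: contraNneq xC => ->.
      by apply: contraNN xC => /(subsetP sS'C); rewrite inE => /andP [].
    by rewrite memS2 => /and3P [yU _ _]; exact: (comps_closed EU xE yU).
  have dis : [disjoint comps R & odd_comps (U :\: S) :\ C].
    apply/pred0P => E /=; apply/negP=> /andP [ER]; rewrite !inE => /and3P [neEC EU _].
    have /set0Pn [x xE] := comps_neq0 ER.
    case/eqP: neEC; apply: (comps_eq EU CU xE).
    exact: (subsetP sRC x (subsetP (comps_sub ER) x xE)).
  have q2 : #|comps R| + #|odd_comps (U :\: S)| <= odd #|C| + #|odd_comps (U :\: S2)|.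
    rewrite (cardsD1 C (odd_comps (U :\: S))) inE CU /= addnCA leq_add2l.
    have /eqP <- : #|comps R :|: odd_comps (U :\: S) :\ C| ==
        #|comps R| + #|odd_comps (U :\: S) :\ C|.
      by rewrite (leq_card_setU _ _).2.
    by apply: subset_leq_card; rewrite subUset sub1.
  have parR : odd #|R| = odd #|comps R|.
    by apply: odd_card_comps => E ER; exact: (factor_critical_odd (comps_neq0 ER) (fc' _ ER)).
  have cardR : #|R| + #|S'| + 1 = #|C|.
    have := cardsD1 c C; have := cardsID S' (C :\ c).
    by rewrite cC (setIidPr sS'C) -/R; clear; lia.
  have imS' : m @: S' \subset comps R.
    by apply/subsetP => _ /imsetP [a aS' ->]; case: (mP a aS').
  have leS' : #|S'| <= #|comps R| by rewrite -(card_in_imset m_inj) subset_leq_card.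
  have cardU : #|U :\: S2| + #|S'| + 1 = #|U :\: S|.
    have := cardsID S U; have := cardsID S2 U; rewrite (setIidPr sSU) (setIidPr S2U).
    by move: cardS2; clear; lia.
  have lt2 : #|odd_comps (U :\: S2)| + #|U :\: S2| < #|odd_comps (U :\: S)| + #|U :\: S|.
    by apply: maxs => //; rewrite cardS2; clear; lia.
  (* Maximality gives [#|comps R| <= #|S'| + odd #|C|]; the parities from [parR] and [cardR] exclude
     a surplus of one. *)
  have eqS' : #|comps R| = #|S'|.
    by move: q2 parR leS' cardU lt2 cardR; clear; lia.
  have defR : comps R = m @: S'.
    by apply/esym/eqP; rewrite eqEcard imS' (card_in_imset m_inj) eqS' leqnn.
  have sm a : a \in S' -> m a \subset R by case/mP => /comps_sub.
  (* Every component of [R] is [m a] for exactly one [a], so [C :\ c] splits into sets [a |: m a],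
     each with a perfect matching. *)
  have -> : C :\ c = \bigcup_(a in S') (a |: m a).
    apply/setP=> x; apply/idP/bigcupP => [xC|[a aS']].
      case: (boolP (x \in S')) => [xS'|xS']; first by exists x; rewrite // !inE eqxx.
      have xR : x \in R by rewrite inE xS'.
      have [E] := comps_cover xR; rewrite defR => /imsetP [a aS' ->] xa.
      by exists a => //; rewrite inE xa orbT.
    case/setU1P=> [->|/(subsetP (sm a aS'))]; first exact: (subsetP sS'C a aS').
    by rewrite inE => /andP [].
  have notR a : a \in S' -> a \notin R by rewrite inE => ->.
  apply: bigcup_disjoint_ind => [|B D|a aS'|a b aS' bS' ab].
  - exact: matchable0.
  - exact: matchableU.
  - have [maR na] := mP a aS'; apply: (factor_critical_matchable _ na (fc' _ maR)).
    by apply: contraNN (notR a aS'); apply: (subsetP (sm a aS') a).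
  - apply/pred0P => x /=; apply/negP => /andP [/setU1P [->|xa] /setU1P [|xb]].
    + by move/eqP; apply/negP.
    + by move: (notR a aS'); rewrite (subsetP (sm b bS')).
    + by move=> xb; move: (notR b bS'); rewrite -xb (subsetP (sm a aS')).
    + case/negP: ab; apply/eqP/m_inj => //.
      exact: (comps_eq (mP a aS').1 (mP b bS').1 xa xb).
(* Hall's condition: returning [B] to the graph destroys at most [#|N|] odd components and shrinks
   the barrier by [#|B|], so maximality forces [#|B| <= #|N|]. *)
have [B sBS|m m_inj mP] := @Hall_marriage _ _ set0
    (fun a => [set D in comps (U :\: S) | nbr a D]) S.
  pose N : {set {set G}} := \bigcup_(a in B) [set D in comps (U :\: S) | nbr a D].
  change (#|B| <= #|N|).
  have sBU : S :\: B \subset U by apply: subset_trans sSU; apply: subsetDl.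
  have sub : odd_comps (U :\: S) :\: N \subset odd_comps (U :\: (S :\: B)).
    apply/subsetP => D; rewrite !inE => /and3P [DN DU ->]; rewrite andbT.
    apply: (mem_comps_sub DU) => [|x y xD yU xy].
      by apply: subset_trans (comps_sub DU) _; apply: setDS; apply: subsetDl.
    case: (boolP (y \in B)) => yB; last first.
      apply: (comps_closed DU xD _ xy); move: yU; rewrite !inE yB /=.
      by case: (y \in S).
    case/negP: DN; apply/bigcupP; exists y => //; rewrite inE DU /=.
    by apply/exists_inP; exists x => //; rewrite adj_sym.
  have := maxq _ sBU; have := subset_leq_card sub.
  have := cardsID N (odd_comps (U :\: S)).
  have := subset_leq_card (subsetIr (odd_comps (U :\: S)) N).
  have := cardsID S U; have := cardsID (S :\: B) U; have := cardsID B S.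
  rewrite (setIidPr sSU) (setIidPr sBU) (setIidPr sBS); clear; lia.
exists S, m; split=> // a aS; have := mP a aS; by rewrite inE => /andP.
Qed.

End Matchings.

(** * Tilings by paths *)

Section Tilings.
Variable G : sgraph.
Implicit Types (U W C D S X : {set G}) (x y z u v : G) (M : G -> G).

(** A factor of the subgraph induced on [U], recorded as the vertex sequences of its paths; these
    paths may have chords in [G]. *)
Definition tileable U := exists ss : seq (seq G),
  [/\ all (fun p => (size p \in [:: 2; 7]) && sorted (@adj G) p) ss,
      uniq (flatten ss) & flatten ss =i U].

Lemma tileable0 : tileable set0.
Proof. by exists [::]; split=> // x; rewrite inE. Qed.

Lemma tileableU U W : [disjoint U & W] -> tileable U -> tileable W ->
  tileable (U :|: W).
Proof.
move=> dUW [ss [ssP ssU ssE]] [tt [ttP ttU ttE]]; exists (ss ++ tt).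
rewrite all_cat ssP ttP flatten_cat cat_uniq ssU ttU /= andbT; split=> //.
  by apply/hasPn => x; rewrite ttE => /(disjointFl dUW); rewrite -ssE => /= ->.
by move=> x; rewrite mem_cat ssE ttE inE.
Qed.

Lemma tileable_path p : size p \in [:: 2; 7] -> sorted (@adj G) p -> uniq p ->
  tileable [set x in p].
Proof.
move=> sp ap up; exists [:: p]; rewrite /= sp ap cats0; split=> // x.
by rewrite inE.
Qed.

Lemma tileable_matchable U : matchable U -> tileable U.
Proof.
case=> M; have [n] := ubnP #|U|; elim: n U => // n IHn U leUn MU.
have [->|[x xU]] := set_0Vmem U; first exact: tileable0.
have [MxU ax Mx] := MU x xU.
have nxM : x != M x by apply: contraTneq ax => <-; rewrite adj_irrefl.
rewrite -(setD1K xU) -(@setD1K _ (M x) (U :\ x)) ?inE ?MxU 1?eq_sym ?nxM // setUA.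
apply: tileableU.
- by rewrite -setI_eq0; apply/eqP/setP=> y; rewrite !inE; do !case: eqP.
- rewrite (_ : _ :|: _ = [set y in [:: x; M x]]); last by apply/setP=> y; rewrite !inE.
  by apply: tileable_path; rewrite //= ?ax // inE nxM.
apply: IHn.
  have := cardsD1 x U; have := cardsD1 (M x) (U :\ x); rewrite !inE xU; lia.
apply: (matched_sub MU) => [|y]; first by rewrite (subset_trans (subsetDl _ _)) ?subsetDl.
rewrite !inE => /and3P [yM yx yU]; have [-> _ My] := MU y yU.
rewrite andbT; apply/andP.
by split; [apply: contraNneq yx | apply: contraNneq yM] => E; rewrite -My E ?Mx.
Qed.

(** The path [p] consists of [x] and three whole edges of [M], so [M] still matches the rest of
    [D]. *)
Lemma tileable_path7 M D x a b c p : matched M (D :\ x) -> x \in D ->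
  a \in D :\ x -> b \in D :\ x -> c \in D :\ x ->
  b \notin [:: a; M a] -> c \notin [:: a; M a; b; M b] ->
  perm_eq p [:: x; a; M a; b; M b; c; M c] -> sorted (@adj G) p ->
  tileable D.
Proof.
move=> MD xD aD bD cD bN cN pE ap; set L := [:: x; _; _; _; _; _; _] in pE.
have [MaD aa Ma] := MD a aD; have [MbD ab Mb] := MD b bD.
have [McD ac Mc] := MD c cD.
have neM y : y \in D :\ x -> y != M y.
  by move=> /MD [_ ay _]; apply: contraTneq ay => <-; rewrite adj_irrefl.
have neMM y z : y \in D :\ x -> z \in D :\ x -> y != z -> M y != M z.
  move=> /MD [_ _ My] /MD [_ _ Mz]; apply: contraNneq => E.
  by rewrite -My E Mz.
have neMl y z : y \in D :\ x -> z \in D :\ x -> M y != z -> y != M z.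
  move=> yD zD; case: (MD z zD) => _ _ Mz; case: (MD y yD) => _ _ My.
  by apply: contraNneq => ->; rewrite Mz.
have nex y : y \in D :\ x -> x != y by rewrite !inE eq_sym => /andP [].
move: bN cN; rewrite !inE !negb_or.
rewrite ![in b == _]eq_sym ![in c == _]eq_sym.
move=> /andP [ba bMa] /and4P [ca cMa cb cMb].
have uL : uniq L.
  rewrite /= !inE !negb_or !nex //= !neM // ba bMa ca cMa cb cMb /=.
  by rewrite !neMM // !neMl.
have sLD : [set y in L] \subset D.
  apply/subsetP=> y; rewrite inE; move: y; apply/allP.
  move: aD bD cD MaD MbD McD; rewrite !inE /= xD.
  by do 6!case/andP=> _ ->.
have -> : D = [set y in p] :|: D :\: [set y in L].
  rewrite -[LHS](setID D [set y in L]) (setIidPr sLD); congr (_ :|: _).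
  by apply/setP=> y; rewrite !inE (perm_mem pE) !inE.
apply: tileableU.
- rewrite -setI_eq0; apply/eqP/setP=> y; rewrite !inE (perm_mem pE).
  by rewrite /L !inE; case: (_ || _) => //=.
- by apply: tileable_path; rewrite ?(perm_uniq pE) // (perm_size pE).
apply: tileable_matchable; exists M.
apply: (matched_sub MD) => [|y].
  by apply/subsetP=> y; rewrite !inE negb_or => /andP [/andP [-> _] ->].
rewrite !inE !negb_or -!andbA => /and4P [yx ya yMa /and5P [yb yMb yc yMc yD]].
have [] := MD y; first by rewrite !inE yx.
rewrite !inE => /andP [-> ->] _ My /=; rewrite andbT.
have nM z : M (M z) = z -> y != M z -> M y != z by move=> Mz; apply: contraNneq => <-; rewrite My.
have nM' z : M (M z) = z -> y != z -> M y != M z.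
  by move=> Mz; apply: contraNneq => E; rewrite -My E Mz.
by rewrite (nM _ Ma) ?(nM' _ Ma) ?(nM _ Mb) ?(nM' _ Mb) ?(nM _ Mc) ?(nM' _ Mc).
Qed.

End Tilings.

(** * Factor-critical graphs without a tiling *)

Section FactorCritical.
Variable G : sgraph.
Implicit Types (U W C D S X : {set G}) (x y z u v : G) (M : G -> G).

(** A perfect matching of [D] minus a vertex outside [C] cannot preserve the odd set [C], so one of
    its edges leaves [C]. *)
Lemma factor_critical_exit D C : factor_critical D -> C \proper D ->
  odd #|C| -> exists c u, [/\ c \in C, u \in D, u \notin C & adj c u].
Proof.
move=> fcD /properP [sCD [u0 u0D u0C]] oddC.
have [M MD] := fcD u0 u0D.
have sC : C \subset D :\ u0 by rewrite subsetD1 sCD.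
case: (boolP [forall c in C, M c \in C]) => [/forall_inP clC|].
  by case/negP: (matchable_even (ex_intro _ M (matched_sub MD sC clC))).
rewrite negb_forall_in => /exists_inP [c cC McC].
have [McD ac _] := MD c (subsetP sC c cC).
by exists c, (M c); split=> //; move: McD; rewrite inE => /andP [].
Qed.

(** The path is [z, M z, c, M y, y, u, M u]: two edges of [M] joined through [c], then a third one
    reached by the edge from [y] to [u]. *)
Lemma tileable_bowtie M D c z y u : matched M (D :\ c) -> c \in D ->
  z \in D :\ c -> y \in D :\ c -> u \in D :\ c ->
  adj c (M z) -> adj c (M y) -> adj y u ->
  u \notin [:: z; M z; M y] -> z \notin [:: y; M y] -> tileable D.
Proof.
move=> MD cD zD yD uD cMz cMy yu uN zN.
have [MzD az Mz] := MD z zD; have [MyD ay My] := MD y yD.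
have [MuD au Mu] := MD u uD.
have nuy : u != y by apply: contraTneq yu => ->; rewrite adj_irrefl.
apply: (@tileable_path7 _ M D c z y u [:: z; M z; c; M y; y; u; M u]) => //.
- move: zN; rewrite !inE !negb_or eq_sym => /andP [-> zMy] /=.
  by apply: contraNneq zMy => ->; rewrite Mz.
- by move: uN; rewrite !inE !negb_or (negPf nuy) => /and3P [-> -> ->].
- by apply/permP=> P /=; clear; lia.
by rewrite /= az (adj_sym (M z)) cMz cMy (adj_sym (M y)) ay yu au.
Qed.

(* The alternating path x, N x, M (N x), ... leads to y. If it gets there after
   two steps then N x = M y; after four steps it closes a 5-cycle, which an edge
   leaving it extends to a P7; otherwise its first seven vertices form a P7. *)
Lemma factor_critical_triangle D M x y : factor_critical D -> 6 < #|D| ->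
  matched M (D :\ x) -> x \in D -> y \in D -> adj x y ->
  tileable D \/ adj x (M y).
Proof.
move=> fcD D7 MD xD yD xy; have [N ND] := fcD y yD.
have neM v L U : matched L U -> v \in U -> v != L v.
  by move=> LU /LU [_ av _]; apply: contraTneq av => <-; rewrite adj_irrefl.
have nxy : x != y by apply: contraTneq xy => ->; rewrite adj_irrefl.
have memx v : (v \in D :\ x) = (v != x) && (v \in D) by rewrite !inE.
have memy v : (v \in D :\ y) = (v != y) && (v \in D) by rewrite !inE.
have xDy : x \in D :\ y by rewrite memy nxy.
have [p1Dy a01 Np1] := ND x xDy; set p1 := N x in p1Dy a01 Np1.
have np1x : p1 != x by rewrite eq_sym; apply: (neM _ _ _ ND).
have p1Dx : p1 \in D :\ x by rewrite memx np1x; move: p1Dy; rewrite memy => /andP [].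
have [p2Dx a12 Mp2] := MD p1 p1Dx; set p2 := M p1 in p2Dx a12 Mp2.
have np12 : p1 != p2 := neM _ _ _ MD p1Dx.
have [p2y|np2y] := eqVneq p2 y; first by right; rewrite -p2y Mp2.
have p2Dy : p2 \in D :\ y by rewrite memy np2y; move: p2Dx; rewrite memx => /andP [].
have [p3Dy a23 Np3] := ND p2 p2Dy; set p3 := N p2 in p3Dy a23 Np3.
have np23 : p2 != p3 := neM _ _ _ ND p2Dy.
have np2x : p2 != x by move: p2Dx; rewrite memx => /andP [].
have np3x : p3 != x by apply: contraNneq np12 => E; rewrite -Np3 E.
have np31 : p3 != p1 by apply: contraNneq np2x => E; rewrite -Np3 E Np1.
have p3Dx : p3 \in D :\ x by rewrite memx np3x; move: p3Dy; rewrite memy => /andP [].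
have [p4Dx a34 Mp4] := MD p3 p3Dx; set p4 := M p3 in p4Dx a34 Mp4.
have np34 : p3 != p4 := neM _ _ _ MD p3Dx.
have np41 : p4 != p1 by apply: contraNneq np23 => E; rewrite /p2 -E Mp4.
have np42 : p4 != p2 by apply: contraNneq np31 => E; rewrite -Mp4 E Mp2.
have np4x : p4 != x by move: p4Dx; rewrite memx => /andP [].
have [p4y|np4y] := eqVneq p4 y; last first.
  have p4Dy : p4 \in D :\ y by rewrite memy np4y; move: p4Dx; rewrite memx => /andP [].
  have [p5Dy a45 Np5] := ND p4 p4Dy; set p5 := N p4 in p5Dy a45 Np5.
  have np45 : p4 != p5 := neM _ _ _ ND p4Dy.
  have np5x : p5 != x by apply: contraNneq np41 => E; rewrite -Np5 E.
  have np51 : p5 != p1 by apply: contraNneq np4x => E; rewrite -Np5 E Np1.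
  have np52 : p5 != p2 by apply: contraNneq np34 => E; rewrite -Np5 E.
  have np53 : p5 != p3 by apply: contraNneq np42 => E; rewrite -Np5 E Np3.
  have p5Dx : p5 \in D :\ x by rewrite memx np5x; move: p5Dy; rewrite memy => /andP [].
  have [p6Dx a56 Mp6] := MD p5 p5Dx.
  left; apply: (@tileable_path7 _ M D x p1 p3 p5 [:: x; p1; p2; p3; p4; p5; M p5]) => //.
  - by rewrite !inE negb_or np31 eq_sym.
  - by rewrite !inE !negb_or np51 np52 np53 eq_sym.
  by rewrite /= a01 a12 a23 a34 a45 a56.
have a40 : adj p4 x by rewrite p4y adj_sym.
pose C := [set v in [:: x; p1; p2; p3; p4]].
have uC : uniq [:: x; p1; p2; p3; p4].
  rewrite /= !inE !negb_or ![in x == _]eq_sym np1x np2x np3x np4x np12.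
  by rewrite ![in p1 == _]eq_sym np31 np41 np23 eq_sym np42 np34.
have cardC : #|C| = 5 by rewrite cardsE; apply/card_uniqP.
have sCD : C \proper D.
  rewrite properEcard cardC (leq_trans _ D7) // andbT; apply/subsetP=> v.
  rewrite inE; move: v; apply/allP; move: p1Dx p2Dx p3Dx p4Dx.
  by rewrite !memx /= xD => /andP [_ ->] /andP [_ ->] /andP [_ ->] /andP [_ ->].
have [|c [u [cC uD uNC cu]]] := factor_critical_exit fcD sCD; first by rewrite cardC.
move: uNC; rewrite !inE !negb_or => /and5P [ux u1 u2 u3 u4].
have uDx : u \in D :\ x by rewrite memx ux.
have [MuDx au Mu] := MD u uDx.
(* The seven vertices are [x] and three edges of [M], starting at [p1], [p3] and [u]; [q] is the
   5-cycle opened so as to end at the exit vertex [c]. *)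
have tile5 q : perm_eq q [:: x; p1; p2; p3; p4] -> sorted (@adj G) (q ++ [:: u; M u]) -> tileable D.
  move=> qE aq; apply: (@tileable_path7 _ M D x p1 p3 u (q ++ [:: u; M u])) => //.
  - by rewrite !inE negb_or np31 eq_sym.
  - by rewrite !inE !negb_or u1 u2 u3.
  by apply: (perm_trans (perm_cat qE (perm_refl _))).
left; move: cC cu; rewrite !inE => /or4P [/eqP ->|/eqP ->|/eqP ->|/orP [] /eqP ->] cu.
- apply: (tile5 [:: p1; p2; p3; p4; x]); first by apply/permP=> P /=; clear; lia.
  by rewrite /= a12 a23 a34 a40 cu au.
- apply: (tile5 [:: p2; p3; p4; x; p1]); first by apply/permP=> P /=; clear; lia.
  by rewrite /= a23 a34 a40 a01 cu au.
- apply: (tile5 [:: p3; p4; x; p1; p2]); first by apply/permP=> P /=; clear; lia.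
  by rewrite /= a34 a40 a01 a12 cu au.
- apply: (tile5 [:: p4; x; p1; p2; p3]); first by apply/permP=> P /=; clear; lia.
  by rewrite /= a40 a01 a12 a23 cu au.
- apply: (tile5 [:: x; p1; p2; p3; p4]); first exact: perm_refl.
  by rewrite /= a01 a12 a23 a34 cu au.
Qed.

(* k triangles sharing the vertex c, with no further edges *)
Definition windmill D c M :=
  [/\ c \in D, matched M (D :\ c), forall y, y \in D :\ c -> adj c y &
      forall y u, y \in D :\ c -> u \in D :\ c -> adj y u -> u = M y].

(** Unless [D] is tileable, some [c] has three neighbours, hence neighbours on two edges of the
    matching [K] of [D :\ c], and by [factor_critical_triangle] [K] preserves the neighbourhood of
    [c]. If [c] misses a vertex, or an edge avoiding [c] is not in [K], then [tileable_bowtie]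
    applies; otherwise [D] is a windmill. *)
Lemma factor_critical_windmill D : factor_critical D -> 6 < #|D| ->
  tileable D \/ exists c M, windmill D c M.
Proof.
move=> fcD D7; have [x xD] : exists x, x \in D by apply/card_gt0P; lia.
have [M MD] := fcD x xD.
have memD v z : (v \in D :\ z) = (v != z) && (v \in D) by rewrite !inE.
have [y [yD xy]] : exists y, y \in D /\ adj x y.
  have /set0Pn [v vDx] : D :\ x != set0 by rewrite -card_gt0; have := cardsD1 x D; lia.
  have [N ND] := fcD v (subsetP (subsetDl _ _) v vDx).
  have [] := ND x; first by move: vDx; rewrite !memD eq_sym => /andP [-> _].
  by rewrite memD => /andP [_ NxD] xNx _; exists (N x).
have [|xMy] := factor_critical_triangle fcD D7 MD xD yD xy; first by left.
have yx : y != x by apply: contraTneq xy => ->; rewrite adj_irrefl.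
have yDx : y \in D :\ x by rewrite memD yx.
have [MyDx yMy My] := MD y yDx.
have [Myx MyD] : M y != x /\ M y \in D by move: MyDx; rewrite memD => /andP.
have nyMy : y != M y by apply: contraTneq yMy => <-; rewrite adj_irrefl.
(* The vertices [x], [y], [M y] form a triangle, an odd set; an edge leaving it gives its end in the
   triangle a third neighbour. *)
have [c [n1 [n2 [n3 [cD [n1D n2D n3D] [c1 c2 c3] [n12 n13 n23]]]]]] :
  exists c n1 n2 n3, [/\ c \in D, [/\ n1 \in D, n2 \in D & n3 \in D],
    [/\ adj c n1, adj c n2 & adj c n3] & [/\ n1 != n2, n1 != n3 & n2 != n3]].
  have cardC : #|[set v in [:: x; y; M y]]| = 3.
    rewrite cardsE; apply/card_uniqP.
    by rewrite /= !inE negb_or eq_sym yx eq_sym Myx nyMy.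
  have sCD : [set v in [:: x; y; M y]] \proper D.
    rewrite properEcard cardC (leq_trans _ D7) // andbT; apply/subsetP=> v.
    by rewrite !inE => /or3P [] /eqP ->.
  have [|c [u [cC uD uNC cu]]] := factor_critical_exit fcD sCD; first by rewrite cardC.
  move: uNC; rewrite !inE !negb_or ![u == _]eq_sym => /and3P [xu yu Myu].
  move: cC cu; rewrite !inE => /or3P [] /eqP -> cu.
  - by exists x, y, (M y), u.
  - by exists y, x, (M y), u; rewrite (adj_sym y x) [x == _]eq_sym.
  - by exists (M y), x, y, u; rewrite (adj_sym (M y) x) (adj_sym (M y) y) [x == _]eq_sym.
have [K KD] := fcD c cD.
have nbrD v : v \in D -> adj c v -> v \in D :\ c.
  by move=> vD cv; rewrite memD vD andbT; apply: contraTneq cv => ->; rewrite adj_irrefl.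
case: (boolP [forall v in D, adj c v ==> adj c (K v)]); last first.
  rewrite negb_forall_in => /exists_inP [v vD]; rewrite negb_imply => /andP [cv cKv].
  have [|cKv'] := factor_critical_triangle fcD D7 KD cD vD cv; first by left.
  by rewrite cKv' in cKv.
move=> /forall_inP clK0; have clK v : v \in D -> adj c v -> adj c (K v).
  by move=> vD; apply/implyP; apply: clK0.
have [z [t [zD tD [cz ct] tN]]] : exists z t, [/\ z \in D, t \in D,
    adj c z /\ adj c t & t \notin [:: z; K z]].
  have [n2K|n2K] := eqVneq n2 (K n1).
    by exists n1, n3; rewrite !inE negb_or -n2K ![n3 == _]eq_sym n13 n23.
  by exists n1, n2; rewrite !inE negb_or eq_sym n12 n2K.
pose N := [set v in D | adj c v].
have sND : N \subset D :\ c by apply/subsetP=> v; rewrite inE => /andP [vD]; apply: nbrD.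
have evenN : ~~ odd #|N|.
  apply: matchable_even; exists K; apply: (matched_sub KD sND) => v.
  rewrite !inE => /andP [vD cv]; rewrite clK // andbT.
  by have [] := KD v (nbrD v vD cv); rewrite memD => /andP [].
have oddcN : odd #|c |: N| by rewrite cardsU1 inE adj_irrefl andbF oddD (negPf evenN).
have sCD : c |: N \subset D.
  by rewrite subUset sub1set cD (subset_trans sND) // subsetDl.
(* An edge leaves the odd set [c |: N], necessarily from a neighbour [c'] of [c]. One of [z], [t]
   provides a neighbour [w] of [c] off the edge of [K] through [c']. *)
case: (boolP (c |: N \proper D)) => [prC|].
  left; have [c' [u [c'C uD uNC c'u]]] := factor_critical_exit fcD prC oddcN.
  move: uNC; rewrite !inE uD negb_or => /andP [uc ncu].
  move: c'C; rewrite !inE => /orP [/eqP E|/andP [vD cv]]; first by rewrite -E c'u in ncu.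
  have [w [wD cw wN]] : exists w, [/\ w \in D, adj c w & w \notin [:: c'; K c']].
    case: (boolP (z \in [:: c'; K c'])) => [|zN]; last by exists z.
    have [_ _ Kc'] := KD c' (nbrD _ vD cv).
    rewrite !inE => /orP [] /eqP E; exists t; split=> //; first by rewrite -E.
    by move: tN; rewrite E Kc' !inE orbC.
  apply: (tileable_bowtie KD cD (nbrD _ wD cw) (nbrD _ vD cv) _ _ _ c'u _ wN).
  - by rewrite memD uc.
  - exact: clK.
  - exact: clK.
  by rewrite !inE !negb_or; apply/and3P; split; apply: contraNneq ncu => ->; rewrite ?clK.
rewrite properE sCD negbK => /subsetP sDC.
have univ v : v \in D :\ c -> adj c v.
  by rewrite memD => /andP [vc /sDC]; rewrite !inE (negPf vc) => /andP [].
case: (boolP [forall v in D :\ c, forall u in D :\ c, adj v u ==> (u == K v)]).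
  move=> /forall_inP H; right; exists c, K; split=> // v u vD uD vu.
  by have /forall_inP/(_ u uD)/implyP/(_ vu)/eqP := H v vD.
rewrite negb_forall_in => /exists_inP [v vD]; rewrite negb_forall_in => /exists_inP [u uD].
rewrite negb_imply => /andP [vu uKv]; left.
(* [D :\ c] has at least six vertices, so one of them avoids the two edges of [K] through [v] and
   [u]. *)
have /subsetPn [w wD wN] : ~~ (D :\ c \subset [set w in [:: v; K v; u; K u]]).
  have le4 : #|[set w in [:: v; K v; u; K u]]| <= 4 by rewrite cardsE card_size.
  apply: contraL D7 => /subset_leq_card le1.
  by move: (leq_trans le1 le4); rewrite -leqNgt (cardsD1 c D) cD; clear; lia.
move: wN; rewrite !inE !negb_or => /and4P [wv wKv wu wKu].
have [KwD _ Kw] := KD w wD; have [KvD _ _] := KD v vD; have [_ _ Ku] := KD u uD.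
apply: (tileable_bowtie KD cD wD vD uD _ _ vu); rewrite ?univ //.
  rewrite !inE !negb_or uKv eq_sym wu andbT /=.
  by apply: contraNneq wKu => ->; rewrite Kw.
by rewrite !inE negb_or wv.
Qed.

End FactorCritical.

(** * Linking barrier vertices with components *)

Section Pieces.
Variables (T K : finType) (e : T -> K -> bool) (nt : pred K).
Implicit Types (S : {set T}) (V N : {set K}) (a b : T) (D v H : K).
Implicit Types (p : seq T * seq K) (ss tt : seq (seq T * seq K)).

(* The links a - D, D - a - D' and D - a - v - b - D', as the lists of their
   vertices on either side; nt marks the components of order at least 3. *)
Definition piece p :=
  match p with
  | ([:: a], [:: D]) => e a D
  | ([:: a], [:: D; D']) => [&& nt D, nt D', e a D & e a D']
  | ([:: a; b], [:: D; v; D']) =>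
      [&& ~~ nt v, nt D, nt D', e a D, e a v, e b v & e b D']
  | _ => false
  end.

Definition lefts ss := flatten [seq p.1 | p <- ss].
Definition rights ss := flatten [seq p.2 | p <- ss].

Definition piecewise ss := [&& all piece ss, uniq (lefts ss) & uniq (rights ss)].

Lemma lefts_cat ss tt : lefts (ss ++ tt) = lefts ss ++ lefts tt.
Proof. by rewrite /lefts map_cat flatten_cat. Qed.

Lemma rights_cat ss tt : rights (ss ++ tt) = rights ss ++ rights tt.
Proof. by rewrite /rights map_cat flatten_cat. Qed.

(* (D, i) is the i-th unit requested by D: three for D in V, one for D in N. *)
Definition units V N : {set K * 'I_3} :=
  [set u | (u.1 \in V) || (u.1 \in N) && (u.2 == ord0)].

(* g assigns to each unit one of the two units offered by some a in T. Removing
   a link D - a - v - b - D' or D - a - D' whenever the units show one, we reach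
   a state where every v in V has two units at vertices not serving N, so Hall's
   condition holds and all remaining links have the form a - D. *)
Lemma pieces_of_units V N (g : K * 'I_3 -> T * bool) :
  [disjoint V & N] -> {in units V N &, injective g} ->
  {in units V N, forall u, e (g u).1 u.1} -> {in V, forall D, ~~ nt D} -> {in N, forall D, nt D} ->
  exists ss, [/\ piecewise ss, rights ss =i V :|: N &
    {subset lefts ss <= [set (g u).1 | u in units V N]}].
Proof.
have [n] := ubnP (#|V| + #|N|); elim: n V N => // n IHn V N leVN dVN g_inj ge ntV ntN.
have unitV v i : v \in V -> (v, i) \in units V N by rewrite inE => ->.
have unitN H : H \in N -> (H, ord0) \in units V N by rewrite inE => /= ->; rewrite orbT.
have dis v H : v \in V -> H \in N -> v != H.
  by move=> vV; apply: contraTneq => <-; rewrite (disjointFr dVN vV).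
(* A vertex carries at most two units, one for each Boolean tag. *)
have pigeon u1 u2 u : u1 \in units V N -> u2 \in units V N -> u \in units V N ->
    u1 != u2 -> (g u1).1 = (g u2).1 -> (g u).1 = (g u1).1 -> (u == u1) || (u == u2).
  move=> uU1 uU2 uU; rewrite -(inj_in_eq g_inj) // -[u == u1](inj_in_eq g_inj) //.
  rewrite -[u == u2](inj_in_eq g_inj) //.
  case: (g u) (g u1) (g u2) => [a []] [b []] [c []] /= + E1 E2; rewrite E2 -E1 ?eqxx ?orbT //.
(* Splits off the link [p]. Both units of each of its left vertices belong to [p], so the links
   found by induction avoid these vertices. *)
have recurse V' N' p : V' \subset V -> N' \subset N -> #|V'| + #|N'| < #|V| + #|N| ->
    piece p -> uniq p.1 -> uniq p.2 -> p.2 =i (V :|: N) :\: (V' :|: N') ->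
    (forall a, a \in p.1 -> exists u1 u2, [/\ u1 \in units V N, u2 \in units V N,
       u1 != u2 & [/\ (g u1).1 = a, (g u2).1 = a,
         u1 \notin units V' N' & u2 \notin units V' N']]) ->
  exists ss, [/\ piecewise ss, rights ss =i V :|: N &
    {subset lefts ss <= [set (g u).1 | u in units V N]}].
  move=> sV sN lt_n pP up1 up2 pR pL.
  have sU : units V' N' \subset units V N.
    apply/subsetP=> u; rewrite !inE => /orP [/(subsetP sV) ->//|/andP [/(subsetP sN) -> ->]].
    by rewrite orbT.
  have [||||||ss [/and3P [ssP ssL ssR] ssE ssU]] := IHn V' N'.
  - by move: lt_n leVN; clear; lia.
  - exact: disjointW sV sN dVN.
  - by move=> u1 u2 /(subsetP sU) + /(subsetP sU); apply: g_inj.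
  - by move=> u /(subsetP sU) /ge.
  - by move=> H /(subsetP sV) /ntV.
  - by move=> H /(subsetP sN) /ntN.
  exists (p :: ss); split.
  - rewrite /piecewise /= pP ssP /lefts /rights /= !cat_uniq up1 up2 ssL ssR !andbT /=.
    apply/andP; split; apply/hasPn => x.
      move/ssU/imsetP => [u uU' ->]; apply/negP => /pL [u1 [u2 [u1U u2U u12 [E1 E2 N1 N2]]]].
      have := pigeon u1 u2 u u1U u2U (subsetP sU _ uU') u12.
      rewrite E1 E2 => /(_ erefl erefl) /orP [] /eqP E.
        by rewrite -E uU' in N1.
      by rewrite -E uU' in N2.
    rewrite ssE => xN; apply/negP => xp; by have := pR x; rewrite xp inE xN.
  - move=> x; rewrite /rights /= mem_cat ssE pR inE.
    case: (boolP (x \in V' :|: N')) => //= [|_]; last by rewrite orbF.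
    by rewrite !inE => /orP [/(subsetP sV) -> //|/(subsetP sN) ->]; rewrite orbT.
  move=> x; rewrite /lefts /= mem_cat => /orP [/pL [u1 [_ [u1U _ _ [<- _ _ _]]]]|].
    exact: imset_f.
  by move/ssU/imsetP => [u uU' ->]; apply: imset_f; apply: (subsetP sU).
have [[[[[v i] j] H] H'] /= /and5P [/andP [vV ij] HN H'N /eqP E1 /eqP E2]|none3] :=
  pickP (fun t : K * 'I_3 * 'I_3 * K * K =>
    let: (v, i, j, H, H') := t in
    [&& (v \in V) && (i != j), H \in N, H' \in N,
        (g (v, i)).1 == (g (H, ord0)).1 & (g (v, j)).1 == (g (H', ord0)).1]).
  have vH := dis v H vV HN; have vH' := dis v H' vV H'N.
  (* Otherwise one vertex would carry three units: two for [v] and one for [H]. *)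
  have ab : (g (v, i)).1 != (g (v, j)).1.
    apply/negP => /eqP E.
    have := pigeon (v, i) (v, j) (H, ord0) (unitV _ _ vV) (unitV _ _ vV) (unitN _ HN) _ E.
    by rewrite !xpair_eqE !eqxx ij -E1 ![H == v]eq_sym (negPf vH) => /(_ isT erefl).
  have HH' : H != H' by apply: contraNneq ab => E; rewrite E1 E2 E.
  apply: (recurse (V :\ v) (N :\ H :\ H')
    ([:: (g (v, i)).1; (g (v, j)).1], [:: H; v; H'])).
  - exact: subsetDl.
  - exact: subset_trans (subsetDl _ _) (subsetDl _ _).
  - have := cardsD1 v V.
    have := subset_leq_card (subset_trans (subsetDl (N :\ H) [set H']) (subsetDl _ _)).
    by rewrite vV; clear; lia.
  - rewrite /= ntV // !ntN // (ge _ (unitV v i vV)) (ge _ (unitV v j vV)).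
    by rewrite E1 (ge _ (unitN H HN)) E2 (ge _ (unitN H' H'N)).
  - by rewrite /= inE ab.
  - by rewrite /= !inE negb_or eq_sym vH HH' vH'.
  - move=> x; rewrite !inE.
    case: (eqVneq x v) => [->|xv] /=; first by rewrite vV (disjointFr dVN vV) !andbF orbT.
    case: (eqVneq x H) => [->|xH] /=; first by rewrite HN (disjointFl dVN HN) !andbF.
    by case: (eqVneq x H') => [->|xH'] /=; rewrite ?H'N ?(disjointFl dVN H'N) ?andNb.
  - move=> a; rewrite !inE => /orP [] /eqP ->.
      exists (v, i), (H, ord0); rewrite unitV // unitN // xpair_eqE (negPf vH) /=.
      by rewrite E1 !inE !eqxx (disjointFr dVN vV) (disjointFl dVN HN) /= ?andbF.
    exists (v, j), (H', ord0); rewrite unitV // unitN // xpair_eqE (negPf vH') /=.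
    by rewrite E2 !inE !eqxx (disjointFr dVN vV) (disjointFl dVN H'N) /= ?andbF.
have [[H H'] /= /and4P [HN H'N HH' /eqP E]|none2] :=
  pickP (fun t : K * K => let: (H, H') := t in
    [&& H \in N, H' \in N, H != H' & (g (H, ord0)).1 == (g (H', ord0)).1]).
  apply: (recurse V (N :\ H :\ H') ([:: (g (H, ord0)).1], [:: H; H'])).
  - exact: subxx.
  - exact: subset_trans (subsetDl _ _) (subsetDl _ _).
  - have := cardsD1 H N; have := subset_leq_card (subsetDl (N :\ H) [set H']).
    by rewrite HN; clear; lia.
  - by rewrite /= !ntN // (ge _ (unitN H HN)) E (ge _ (unitN H' H'N)).
  - by [].
  - by rewrite /= !inE HH'.
  - move=> x; rewrite !inE.
    case: (eqVneq x H) => [->|xH] /=; first by rewrite HN (disjointFl dVN HN) !andbF.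
    by case: (eqVneq x H') => [->|xH'] /=; rewrite ?H'N ?(disjointFl dVN H'N) ?andNb.
  - move=> a; rewrite !inE => /eqP ->.
    exists (H, ord0), (H', ord0); rewrite !unitN // xpair_eqE (negPf HH') /=.
    by rewrite E !inE !eqxx (disjointFl dVN HN) (disjointFl dVN H'N) /= ?andbF.
pose hN := [set (g (H, ord0)).1 | H in N].
have [VN0|[u uVN]] := set_0Vmem (V :|: N).
  by exists [::]; split=> // x; rewrite VN0 inE.
pose e' v := [set (g (v, i)).1 | i : 'I_3] :\: hN.
have [B sBV|r r_inj rP] := @Hall_marriage K T (g (u, ord0)).1 e' V.
  pose J v := [set i : 'I_3 | (g (v, i)).1 \notin hN].
  have J2 v : v \in B -> 2 <= #|J v|.
    move=> vB; have vV := subsetP sBV v vB.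
    (* Two units of [v] at vertices serving [N] would form a link through [v], which [none3]
       excludes. *)
    have : #|~: J v| <= 1.
      apply/card_le1_eqP=> i j; rewrite !inE !negbK.
      move=> /imsetP [H HN E1] /imsetP [H' H'N E2]; apply/eqP/negPn/negP=> ij.
      by have := none3 (v, i, j, H, H'); rewrite /= vV eq_sym ij HN H'N E1 E2 !eqxx.
    by have := cardsC (J v); rewrite card_ord; clear; lia.
  pose W := [set u : K * 'I_3 | (u.1 \in B) && (u.2 \in J u.1)].
  have leW : #|B| * 2 <= #|W|.
    rewrite -sum_nat_const; apply: (@leq_trans (\sum_(v in B) #|J v|)); first exact: leq_sum.
    under eq_bigr => v _ do rewrite -sum1_card.
    by rewrite pair_big_dep -sum1_card; apply/eq_leq/eq_bigl => w; rewrite [RHS]inE.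
  have sWU : W \subset units V N.
    by apply/subsetP=> w; rewrite !inE => /andP [/(subsetP sBV) ->].
  have leN : #|g @: W| <= #|setX (\bigcup_(v in B) e' v) [set: bool]|.
    apply: subset_leq_card; apply/subsetP=> _ /imsetP [[v i] vi ->].
    move: vi; rewrite 3!inE /= => /andP [vB iN]; rewrite !inE andbT.
    by apply/bigcupP; exists v; rewrite ?in_setD ?iN /=; [|apply/imsetP; exists i].
  (* At least [2 * #|B|] units are placed injectively on pairs of a vertex and a Boolean, so they
     occupy at least [#|B|] vertices. *)
  move: leN; rewrite card_in_imset; last first.
    by move=> w1 w2 /(subsetP sWU) + /(subsetP sWU); apply: g_inj.
  by rewrite cardsX cardsT card_bool; move: leW; clear; lia.
pose R D := if D \in V then r D else (g (D, ord0)).1.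
have RE D : D \in V :|: N -> exists2 w, w \in units V N & w.1 = D /\ (g w).1 = R D.
  rewrite inE /R; case: ifPn => [DV _|DV /= DN]; last first.
    by exists (D, ord0); rewrite ?unitN.
  by have := rP D DV; rewrite inE => /andP [_ /imsetP [i _ ->]]; exists (D, i); rewrite ?unitV.
exists [seq ([:: R D], [:: D]) | D <- enum (V :|: N)].
rewrite /piecewise /lefts /rights -!map_comp /comp /= !flatten_map1 map_id.
split; last first.
- move=> _ /mapP [D + ->]; rewrite mem_enum => /RE [w wU [_ <-]].
  exact: imset_f.
- by move=> x; rewrite mem_enum.
rewrite enum_uniq andbT; apply/andP; split.
  rewrite all_map; apply/allP => D; rewrite mem_enum => /RE [w wU [<- E]] /=.
  by rewrite -E; apply: ge.
rewrite map_inj_in_uniq ?enum_uniq // => D D'; rewrite !mem_enum !inE /R.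
have VN v H : v \in V -> H \in N -> r v != (g (H, ord0)).1.
  move=> vV HN; have := rP v vV; rewrite inE => /andP [+ _].
  by apply: contraNneq => ->; apply: imset_f.
case: ifPn => [DV _|DV /= DN]; case: ifPn => [D'V _|D'V /= D'N] E.
- exact: r_inj.
- by have := VN _ _ DV D'N; rewrite E eqxx.
- by have := VN _ _ D'V DN; rewrite E eqxx.
- apply/eqP/negPn/negP=> DD'; have := none2 (D, D').
  by rewrite /= DN D'N DD' E eqxx.
Qed.

End Pieces.

(** * Extending the links to the whole barrier *)

Section Augment.
Variables (T K : finType) (e : T -> K -> bool) (nt : pred K).
Implicit Types (S : {set T}) (V N : {set K}) (a b : T) (D v H : K).
Implicit Types (p : seq T * seq K) (ss tt : seq (seq T * seq K)).

Lemma perm_lefts ss tt : perm_eq ss tt -> perm_eq (lefts ss) (lefts tt).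
Proof. by move=> E; apply/perm_flatten/perm_map. Qed.

Lemma perm_rights ss tt : perm_eq ss tt -> perm_eq (rights ss) (rights tt).
Proof. by move=> E; apply/perm_flatten/perm_map. Qed.

Lemma perm_piecewise ss tt : perm_eq ss tt ->
  piecewise e nt ss = piecewise e nt tt.
Proof.
move=> E; rewrite /piecewise (perm_all _ E) (perm_uniq (perm_lefts E)).
by rewrite (perm_uniq (perm_rights E)).
Qed.

(* For an uncovered a, attach m a to a. This splits the link of m a unless it is
   a' - m a; then a and m a are set aside and a' becomes the uncovered vertex. *)
Lemma augment_pieces (m : T -> K) S ss : piecewise e nt ss ->
  {subset lefts ss <= S} -> {in S &, injective m} ->
  {in S, forall a, e a (m a)} ->
  exists tt, [/\ piecewise e nt tt, lefts tt =i S,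
    {subset rights ss <= rights tt} &
    forall D, D \in rights tt -> D \in rights ss \/ D \in m @: S].
Proof.
(* The measure also counts [S]: when [a] is set aside, [S] shrinks while [a'] replaces [a] among the
   uncovered vertices. *)
have [n] := ubnP (#|S| + #|S :\: [set a in lefts ss]|).
elim: n S ss => // n IHn S ss le_n ssP sS m_inj em.
have [sub|[a aN]] := set_0Vmem (S :\: [set a in lefts ss]).
  exists ss; split=> // [a|D DR]; last by left.
  apply/idP/idP => [/sS //|aS]; have /setP/(_ a) := sub.
  by rewrite !inE aS andbT => /negbFE.
move: aN; rewrite !inE => /andP [aN aS].
have grow ss1 : piecewise e nt ss1 -> lefts ss1 =i a :: lefts ss ->
    {subset rights ss <= rights ss1} ->
    (forall D, D \in rights ss1 -> D \in rights ss \/ D \in m @: S) ->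
  exists tt, [/\ piecewise e nt tt, lefts tt =i S,
    {subset rights ss <= rights tt} &
    forall D, D \in rights tt -> D \in rights ss \/ D \in m @: S].
  move=> ss1P ss1L ss1R ss1R'.
  have [||tt [ttP ttL ttR ttR']] := IHn S ss1 _ ss1P _ m_inj em.
  - have: #|S :\: [set a in lefts ss1]| < #|S :\: [set a in lefts ss]|.
      apply: proper_card; apply/properP; split; last by exists a; rewrite !inE ?aN ?ss1L ?mem_head.
      by apply/subsetP=> b; rewrite !inE ss1L inE negb_or -andbA => /and3P [_ -> ->].
    by move: le_n; clear; lia.
  - by move=> b; rewrite ss1L inE => /orP [/eqP ->|/sS].
  exists tt; split=> // D; first by move/ss1R/ttR.
  by move/ttR' => [/ss1R'|]; [|right].
have [ssA ssL ssR] := and3P ssP.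
have [|DN] := boolP (m a \in rights ss); last first.
  apply: (grow (([:: a], [:: m a]) :: ss)) => //.
  - by rewrite /piecewise /= em // ssA aN DN ssL ssR.
  - by move=> D DR; rewrite inE DR orbT.
  - by move=> D; rewrite inE => /orP [/eqP ->|]; [right; apply: imset_f|left].
case/flatten_mapP=> p p_ss Dp.
move: (rem p ss) (perm_to_rem p_ss) => tt pE.
have /and3P [/= /andP [pP ttA] ptL ptR] : piecewise e nt (p :: tt).
  by rewrite -(perm_piecewise pE).
have lE := perm_mem (perm_lefts pE); have rE := perm_mem (perm_rights pE).
have replace q : all (piece e nt) q -> perm_eq (lefts q) (a :: p.1) ->
    perm_eq (rights q) p.2 ->
  exists tt, [/\ piecewise e nt tt, lefts tt =i S,
    {subset rights ss <= rights tt} &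
    forall D, D \in rights tt -> D \in rights ss \/ D \in m @: S].
  move=> qA qL qR.
  have PL : perm_eq (lefts (q ++ tt)) (a :: lefts (p :: tt)).
    by rewrite lefts_cat /lefts /= -cat_cons perm_cat2r.
  have PR : perm_eq (rights (q ++ tt)) (rights (p :: tt)).
    by rewrite rights_cat /rights /= perm_cat2r.
  apply: (grow (q ++ tt)).
  - by rewrite /piecewise all_cat qA ttA (perm_uniq PL) (perm_uniq PR) /= ptL ptR -lE aN.
  - by move=> b; rewrite (perm_mem PL) !inE lE.
  - by move=> D; rewrite rE (perm_mem PR).
  - by move=> D; rewrite rE (perm_mem PR); left.
have ea : e a (m a) by apply: em.
case: p Dp pP {p_ss} pE ptL ptR lE rE replace
  => [[|a' [|b' [|? ?]]] [|D1 [|D2 [|D3 [|? ?]]]]] //=.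
- rewrite inE => /eqP ED eaD pE ptL ptR lE rE _.
  have neaa' : a' != a by apply: contraNneq aN => <-; rewrite lE mem_head.
  have a'S : a' \in S by apply: sS; rewrite lE mem_head.
  have tS b : b \in lefts tt -> b \in S :\ a.
    move=> bt; have bs : b \in lefts ss by rewrite lE inE bt orbT.
    by rewrite !inE sS // andbT; apply: contraNneq aN => <-.
  have [||||tt' [/and3P [ttA' ttL' ttR'] ttL ttR ttR2]] := IHn (S :\ a) tt _ _ tS.
  - rewrite -ltnS; apply: leq_ltn_trans le_n.
    rewrite [in leqRHS](cardsD1 a S) aS add1n addSn ltnS leq_add2l.
    have Aa : a \in S :\: [set b in lefts ss] by rewrite !inE aN.
    rewrite [leqRHS](cardsD1 a) Aa.
    apply: (@leq_trans #|a' |: ((S :\: [set b in lefts ss]) :\ a)|).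
      apply: subset_leq_card; apply/subsetP=> b; rewrite !inE lE inE.
      by rewrite -/(lefts tt); case: (b == a'); case: (b == a); case: (b \in lefts tt).
    by rewrite cardsU1 leq_add2r leq_b1.
  - by move: ptL ptR; rewrite /piecewise ttA => /= /andP [_ ->] /andP [_ ->].
  - by move=> b c /setD1P [_ bS] /setD1P [_ cS]; apply: m_inj.
  - by move=> b /setD1P [_ /em].
  (* [m a] does not occur in [tt']: its link was removed, and by injectivity of [m] no other vertex
     is matched to it. *)
  exists (([:: a], [:: m a]) :: tt'); split.
  - rewrite /piecewise /= ea ttA' /lefts /rights /= -/(lefts tt') -/(rights tt').
    rewrite ttL' ttR' ttL !inE eqxx /=.
    rewrite andbT; apply/negP => /ttR2 [].
      by rewrite ED; move: ptR => /= /andP [/negP].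
    by case/imsetP=> b /setD1P [ba bS] /m_inj E; rewrite E ?eqxx in ba.
  - move=> b; rewrite inE ttL !inE; case: eqP => //= ->; by rewrite aS.
  - by move=> D; rewrite rE !inE ED => /orP [->//|/ttR ->]; rewrite orbT.
  - move=> D; rewrite inE => /orP [/eqP ->|/ttR2 []]; first by right; apply: imset_f.
      by move=> DR; left; rewrite rE inE DR orbT.
    by case/imsetP=> b /setD1P [_ bS] ->; right; apply: imset_f.
- rewrite !inE => Dp /and4P [nt1 nt2 e1 e2] _ _ _ _ _ /(_ (if m a == D1
    then [:: ([:: a], [:: D1]); ([:: a'], [:: D2])]
    else [:: ([:: a], [:: D2]); ([:: a'], [:: D1])])).
  case: eqP Dp ea => [-> _|_ /eqP ->] ea /= rep;
    by apply: rep; rewrite /= ?ea ?e1 ?e2 //; apply/permP => P /=; clear; lia.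
(* Whichever of the three components [a] takes, [a'] and [b'] can each keep one of the other two. *)
- rewrite !inE => Dp /and4P [_ nt1 nt2 /and4P [e1 e2 e3 e4]] _ _ _ _ _ /(_ (
    if m a == D1 then [:: ([:: a], [:: D1]); ([:: a'], [:: D2]); ([:: b'], [:: D3])]
    else if m a == D2 then [:: ([:: a], [:: D2]); ([:: a'], [:: D1]); ([:: b'], [:: D3])]
    else [:: ([:: a], [:: D3]); ([:: a'], [:: D1]); ([:: b'], [:: D2])])).
  case: eqP Dp ea => [-> _|_ /= Dp]; last case: eqP Dp => [-> _|_ /eqP ->];
    move=> ea /= rep; apply: rep; rewrite /= ?ea ?e1 ?e2 ?e3 ?e4 //;
    by apply/permP => P /=; clear; lia.
Qed.

End Augment.

(** * Weighted count of small components *)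

Lemma leq_sum_sub (T : finType) (A B : {set T}) (F : T -> nat) :
  A \subset B -> \sum_(x in A) F x <= \sum_(x in B) F x.
Proof. by move=> sAB; rewrite [leqRHS](big_setID A) /= (setIidPr sAB) leq_addr. Qed.

Lemma leq_card_bigcup (T I : finType) (A : {set I}) (F : I -> {set T}) :
  #|\bigcup_(i in A) F i| <= \sum_(i in A) #|F i|.
Proof.
elim/big_rec2: _ => [|i n B _ leBn]; first by rewrite cards0.
by apply: leq_trans (leq_card_setU _ _) _; rewrite leq_add2l.
Qed.

Section Weight.
Variable G : sgraph.
Implicit Types (U W C D S X : {set G}) (x y z u v : G) (M : G -> G).

(** The contribution of a component of order [n] to three times the left side of the hypothesis,
    which keeps the counting in [nat]. *)
Definition wt n := 3 * (n == 1) + (n == 3) + (n == 5).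

Definition weight U := \sum_(C in comps U) wt #|C|.

Lemma comps_delete X : comps (~: X) \subset
  [set val @: C | C : {set delete X} in components (delete X)].
Proof.
apply/subsetP=> _ /imsetP [x xX ->].
have [x' Ex] : exists x' : delete X, val x' = x by exists (Sub x xX).
apply/imsetP; exists [set y in [set: delete X] | connect (@adj (delete X)) x' y].
  by apply: imset_f; rewrite inE.
apply/setP=> y; apply/idP/imsetP.
  rewrite inE => /andP [yX /connectP [p pth ->]] {yX}.
  suff [y' [xy' E]] : exists y' : delete X,
      connect (@adj (delete X)) x' y' /\ val y' = last x p.
    by exists y'; rewrite ?inE.
  elim: p x x' Ex pth {xX} => [|t p IHp] z z' Ez /=; first by exists z'.
  case/andP => /and3P [_ tX zt] pth.
  have [y' [ty' E]] := IHp t (Sub t tX : delete X) erefl pth.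
  exists y'; split=> //; apply: connect_trans ty'; apply: connect1.
  by rewrite /= /induced_adj /= Ez.
case=> y'; rewrite !inE /= => xy' ->; rewrite -in_setC (valP y') /=.
case/connectP: xy' => p; elim: p x x' Ex {xX} => [|t p IHp] z z' Ez /=.
  by move=> _ ->; rewrite Ez connect0.
case/andP=> zt pth E; apply: connect_trans (IHp (val t) t erefl pth E).
apply: connect1; rewrite -Ez; apply/and3P; split; [exact: (valP z')|exact: (valP t)|exact: zt].
Qed.

Lemma weight_delete X : weight (~: X) <=
  3 * ncomp 1 (delete X) + ncomp 3 (delete X) + ncomp 5 (delete X).
Proof.
have count i : \sum_(C in comps (~: X)) (#|C| == i) <= ncomp i (delete X).
  rewrite -big_mkcondr sum1_card /ncomp.
  rewrite -(card_imset _ (imset_inj val_inj)); apply: subset_leq_card.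
  apply/subsetP=> C /andP [/(subsetP (comps_delete X)) /imsetP [C' C'X ->]].
  by rewrite card_imset => [Ci|]; [apply: imset_f; rewrite inE C'X | apply: val_inj].
rewrite /weight /wt 2!big_split /= -big_distrr /=.
by rewrite !leq_add // leq_mul2l count.
Qed.

(* Excess of the weight over 2 |X| that a bad component has to supply: three
   units for a single vertex, one otherwise. *)
Definition demand D := if #|D| == 1 then 3 else 1.

Definition bad D :=
  [exists X : {set G}, (X \subset D) && (demand D + 2 * #|X| <= weight (D :\: X))].

(** With [X] empty, the connected set [D] itself contributes 3, 1 or 1 when its order is 1, 3 or
    5. *)
Lemma bad_small D : D \in comps D -> odd #|D| -> #|D| <= 6 -> bad D.
Proof.
move=> DD oddD D6; apply/existsP; exists set0.
rewrite sub0set cards0 muln0 addn0 setD0 /weight (bigD1 D) //=.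
apply: leq_trans (leq_addr _ _); rewrite /demand /wt.
by case: #|D| oddD D6 => [|[|[|[|[|[|[|?]]]]]]].
Qed.

Lemma bad_windmill D c M : windmill D c M -> 6 < #|D| -> bad D.
Proof.
case=> cD MD univ indep D7; have [Y [dY defD cardD]] := matched_half MD.
have cardDc : #|D| = (#|D :\ c|).+1 by rewrite (cardsD1 c D) cD.
have cY : c \notin Y.
  apply/negP => cY; have : c \in D :\ c by rewrite -defD inE cY.
  by rewrite !inE eqxx.
(* Deleting c and one vertex of each triangle isolates the other vertices. *)
apply/existsP; exists (c |: Y).
have sY : Y \subset D :\ c by rewrite -defD subsetUl.
have -> : D :\: (c |: Y) = M @: Y.
  rewrite -setDDl -defD setDUl setDv set0U; apply/setDidPl.
  by rewrite disjoint_sym.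
have M_inj : {in Y &, injective M}.
  by move=> x y /(subsetP sY) /MD [_ _ {2}<-] /(subsetP sY) /MD [_ _ {2}<-] ->.
apply/andP; split; first by rewrite subUset sub1set cD (subset_trans sY) ?subsetDl.
rewrite /demand (_ : #|D| == 1 = false); last by apply/eqP; move: D7; clear; lia.
have sZ : [set [set z] | z in M @: Y] \subset comps (M @: Y).
  apply/subsetP=> _ /imsetP [z zZ ->].
  apply: (mem_comps_sub (comps1 z)) => [|x y]; first by rewrite sub1set.
  move/set1P=> -> yZ zy; exfalso.
  have sZ x' : x' \in M @: Y -> x' \in D :\ c by rewrite -defD inE => ->; rewrite orbT.
  (* The only neighbour of [z] in [D :\ c] is its partner [w], which lies in [Y] and hence not in
     [M @: Y]. *)
  have /imsetP [w wY Ez] := zZ; have [_ _ Mw] := MD w (subsetP sY w wY).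
  have yE : y = w by rewrite (indep z y (sZ _ zZ) (sZ _ yZ) zy) Ez.
  by have := disjointFr dY wY; rewrite -yE yZ.
apply: leq_trans (leq_sum_sub _ sZ).
rewrite big_imset /=; last by move=> x y _ _; apply: set1_inj.
under eq_bigr => z _ do rewrite cards1.
(* With k triangles, the deleted set has k + 1 vertices and leaves k isolated ones, so the claim is
   1 + 2(k + 1) <= 3k; order at least 7 means k >= 3. *)
rewrite sum_nat_const card_in_imset // cardsU1 cY.
by move: D7 cardDc cardD; rewrite /wt; clear; lia.
Qed.

Lemma bad_or_tileable D : D \in comps D -> factor_critical D ->
  bad D \/ tileable D.
Proof.
move=> DD fcD; have oddD := factor_critical_odd (comps_neq0 DD) fcD.
have [D6|D7] := leqP #|D| 6; first by left; apply: bad_small.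
have [|[c [M wD]]] := factor_critical_windmill fcD D7; first by right.
by left; apply: bad_windmill wD D7.
Qed.

(** Let [X] consist of [B] and a witness [F D] of badness for each [D] in [P]. Since [B] separates
    the sets of [P] from the rest of [S], the components of each [D :\: F D] are components of
    [~: X]. The hypothesis for [X] then bounds the sum of the demands plus twice that of the
    [#|F D|], and the latter cancels. *)
Lemma sum_demand S (P : {set {set G}}) :
  (forall X, weight (~: X) <= 2 * #|X|) ->
  P \subset comps (~: S) -> (forall D, D \in P -> bad D) ->
  \sum_(D in P) demand D <= 2 * #|[set x in S | [exists D in P, nbr x D]]|.
Proof.
move=> hG sP badP; set B := [set x in S | _].
pose F D := odflt set0 [pick X : {set G} |
  (X \subset D) && (demand D + 2 * #|X| <= weight (D :\: X))].
have FP D : D \in P -> F D \subset D /\ demand D + 2 * #|F D| <= weight (D :\: F D).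
  move/badP/existsP => [X XP]; rewrite /F.
  by case: pickP => [? /andP //|/(_ X)]; rewrite XP.
pose X := B :|: \bigcup_(D in P) F D.
have cardX : #|X| <= #|B| + \sum_(D in P) #|F D|.
  by apply: leq_trans (leq_card_setU _ _) _; rewrite leq_add2l leq_card_bigcup.
have DF D : D \in P -> [/\ forall x, x \in D -> x \notin S & D :\: F D \subset ~: X].
  move=> DP; have DS := subsetP sP D DP.
  have DnS x : x \in D -> x \notin S by move/(subsetP (comps_sub DS)); rewrite inE.
  split=> //; apply/subsetP=> x; rewrite !inE negb_or => /andP [xF xD].
  rewrite (negPf (DnS x xD)) /=; apply/bigcupP => [[D' D'P xD']].
  have [sFD' _] := FP D' D'P.
  have E := comps_eq DS (subsetP sP D' D'P) xD (subsetP sFD' x xD').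
  by rewrite E xD' in xF.
(* Empty outside [P], so that the sets [Q D] are pairwise disjoint over all indices. *)
pose Q D := if D \in P then comps (D :\: F D) else set0.
have sQ : \bigcup_D Q D \subset comps (~: X).
  apply/bigcupsP=> D _; rewrite /Q; case: ifPn => [DP|_]; last exact: sub0set.
  have [DnS sDX] := DF D DP; have DS := subsetP sP D DP.
  apply: sub_comps sDX _ => x y; rewrite !inE negb_or => /andP [xF xD].
  move=> /andP [yB yF] xy.
  have yS : y \notin S.
    apply: contraNN yB => yS; rewrite yS; apply/exists_inP; exists D => //.
    by apply/exists_inP; exists x; rewrite // adj_sym.
  rewrite (comps_closed DS xD _ xy) ?inE // andbT.
  by apply: contraNN yF => yF; apply/bigcupP; exists D.
have := hG X; rewrite /weight => leX.
have := leq_trans (leq_sum_sub (fun C => wt #|C|) sQ) leX.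
rewrite partition_disjoint_bigcup /= => [|D D' DD']; last first.
  apply/pred0P=> C /=; apply/negP; rewrite /Q.
  case: ifPn => [DP|]; last by rewrite inE.
  case: ifPn => [D'P|]; last by rewrite inE andbF.
  move=> /andP [CD CD']; have /set0Pn [x xC] := comps_neq0 CD.
  have xD : x \in D by have := subsetP (comps_sub CD) x xC; rewrite inE => /andP [].
  have xD' : x \in D' by have := subsetP (comps_sub CD') x xC; rewrite inE => /andP [].
  by case/eqP: DD'; apply: comps_eq xD xD'; apply: (subsetP sP).
move=> le2; rewrite -(leq_add2r (2 * \sum_(D in P) #|F D|)) -mulnDr.
apply: leq_trans (leq_trans le2 _); last by rewrite leq_mul2l cardX.
rewrite big_distrr -big_split big_mkcond; apply: leq_sum => D _; rewrite /Q.
by case: ifPn => // DP; apply: (FP D DP).2.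
Qed.

End Weight.

(** * Tiling the linked components *)

Section Assembly.
Variable G : sgraph.
Implicit Types (U W C D S X : {set G}) (x y z u v : G) (M : G -> G).

(** A matching of [D] minus another vertex gives a neighbour [y] of [x]; the matching [M] of
    [D :\ x] gives [z] as the partner of [y] and matches the rest. *)
Lemma factor_critical_tail D x : factor_critical D -> x \in D -> 1 < #|D| ->
  exists y z R, [/\ D = [set t in [:: x; y; z]] :|: R,
    [disjoint [set t in [:: x; y; z]] & R],
    uniq [:: x; y; z], adj x y /\ adj y z & matchable R].
Proof.
move=> fcD xD D1.
have /set0Pn [v] : D :\ x != set0 by rewrite -card_gt0; have := cardsD1 x D; lia.
rewrite !inE => /andP [vx vD]; have [N ND] := fcD v vD.
have [|yD xy _] := ND x; first by rewrite !inE eq_sym vx.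
move: (N x) yD xy => y; rewrite !inE => /andP [_ yD] xy.
have yx : y != x by apply: contraTneq xy => ->; rewrite adj_irrefl.
have [M MD] := fcD x xD; have [|zD yz Mz] := MD y; first by rewrite !inE yx.
have yMy : y != M y by apply: contraTneq yz => <-; rewrite adj_irrefl.
move: zD; rewrite !inE => /andP [zx zD].
have sD : [set t in [:: x; y; M y]] \subset D.
  by apply/subsetP=> t; rewrite !inE => /or3P [] /eqP ->.
exists y, (M y), (D :\: [set t in [:: x; y; M y]]); split=> //.
- by rewrite -{1}(setID D [set t in [:: x; y; M y]]) (setIidPr sD).
- by apply/pred0P=> t /=; rewrite in_setD; case: (t \in [set _ in _]).
- by rewrite /= !inE negb_or eq_sym yx eq_sym zx yMy.
exists M; apply: (matched_sub MD) => [|t].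
  by apply/subsetP=> t; rewrite !inE !negb_or => /andP [/and3P [-> _ _] ->].
rewrite !inE !negb_or => /andP [/and3P [tx ty tz] tD].
have [|+ _ Mt] := MD t; first by rewrite !inE tx.
rewrite !inE => /andP [-> ->]; rewrite andbT /=; apply/andP; split.
  by apply: contraNneq tz => <-; rewrite Mt.
by apply: contraNneq ty => E; rewrite -Mt E Mz.
Qed.

(** Common step for the two longer links: [p] runs through [s1], the connecting vertices [q], and
    [s2], while [R1] and [R2] are matched internally. *)
Lemma tileable_join D1 D2 R1 R2 (s1 s2 q p : seq G) :
  D1 = [set t in s1] :|: R1 -> [disjoint [set t in s1] & R1] ->
  D2 = [set t in s2] :|: R2 -> [disjoint [set t in s2] & R2] ->
  [disjoint D1 & D2] -> {in q, forall t, t \notin D1 :|: D2} ->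
  uniq s1 -> uniq s2 -> uniq q -> perm_eq p (s1 ++ q ++ s2) -> size p = 7 ->
  sorted (@adj G) p -> matchable R1 -> matchable R2 ->
  tileable ([set t in q] :|: (D1 :|: D2)).
Proof.
move=> E1 d1 E2 d2 d12 qD u1 u2 uq pE sp ap m1 m2.
have s1D t : t \in s1 -> t \in D1 by rewrite E1 !inE => ->.
have s2D t : t \in s2 -> t \in D2 by rewrite E2 !inE => ->.
have R1D : R1 \subset D1 by rewrite E1 subsetUr.
have R2D : R2 \subset D2 by rewrite E2 subsetUr.
have qD1 t : t \in q -> t \notin D1 by move/qD; rewrite inE negb_or => /andP [].
have qD2 t : t \in q -> t \notin D2 by move/qD; rewrite inE negb_or => /andP [].
have -> : [set t in q] :|: (D1 :|: D2) = [set t in p] :|: (R1 :|: R2).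
  apply/setP=> t; rewrite E1 E2 !inE (perm_mem pE) !mem_cat.
  by do !case: (t \in _).
apply: tileableU.
- apply/pred0P => t /=; apply/negP; rewrite !inE (perm_mem pE) !mem_cat.
  case/andP => /or3P [t1|tq|t2] /orP [tR|tR].
  + by have := disjointFr d1; move/(_ t); rewrite inE t1 tR => /(_ isT).
  + by have := disjointFr d12 (s1D t t1); rewrite (subsetP R2D).
  + by have := qD1 t tq; rewrite (subsetP R1D).
  + by have := qD2 t tq; rewrite (subsetP R2D).
  + by have := disjointFl d12 (s2D t t2); rewrite (subsetP R1D).
  + by have := disjointFr d2; move/(_ t); rewrite inE t2 tR => /(_ isT).
- apply: tileable_path; rewrite ?sp // (perm_uniq pE) !cat_uniq u1 u2 uq /= andbT.
  apply/andP; split; apply/hasPn => t /=; last by move/s2D => tD; apply: contraL tD => /qD2.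
  rewrite mem_cat => tq2; apply/negP => /s1D tD1.
  by case/orP: tq2 => [/qD1|/s2D /(disjointFl d12)]; rewrite tD1.
- by apply: tileable_matchable; apply: matchableU => //; apply: disjointW d12.
Qed.

Definition covered (s : seq G) (Ds : seq {set G}) : {set G} :=
  [set x | (x \in s) || has (fun D : {set G} => x \in D) Ds].

Let nontrivial D := 1 < #|D|.

(** A link [a - D] has a perfect matching. In [D - a - D'] the seven vertices split as 3 + 1 + 3,
    using a tail on each side; in [D - a - v - b - D'] they split as 3 + 3 + 1. *)
Lemma tileable_piece S (p : seq G * seq {set G}) :
  (forall C, C \in comps (~: S) -> factor_critical C) ->
  piece (@nbr G) nontrivial p -> uniq p.1 -> uniq p.2 ->
  {subset p.1 <= S} -> {subset p.2 <= comps (~: S)} ->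
  tileable (covered p.1 p.2).
Proof.
move=> fcS; have notS C t : C \in comps (~: S) -> t \in C -> t \notin S.
  by move=> /comps_sub /subsetP sC /sC; rewrite inE.
have dis C D : C \in comps (~: S) -> D \in comps (~: S) -> C != D -> [disjoint C & D].
  move=> CS DS neCD; apply/pred0P=> t /=; apply: contraNF neCD => /andP [tC tD].
  by apply/eqP; exact: (comps_eq CS DS tC tD).
case: p => [[|a [|b [|? ?]]] [|D [|v [|D' [|? ?]]]]] //=.
- move=> aD _ _ sS sD; have aS : a \in S by apply: sS; rewrite mem_head.
  have DS : D \in comps (~: S) by apply: sD; rewrite mem_head.
  have -> : covered [:: a] [:: D] = a |: D by apply/setP=> t; rewrite !inE /= ?inE orbF.
  apply/tileable_matchable/factor_critical_matchable => //; last exact: fcS.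
  by apply: contraTN aS; apply: notS.
- move: v => D' /and4P [nD nD' aD aD'] _ uD sS sD.
  have aS : a \in S by apply: sS; rewrite mem_head.
  have DS : D \in comps (~: S) by apply: sD; rewrite mem_head.
  have D'S : D' \in comps (~: S) by apply: sD; rewrite !inE eqxx orbT.
  have -> : covered [:: a] [:: D; D'] = [set t in [:: a]] :|: (D :|: D').
    by apply/setP=> t; rewrite !inE /= ?inE orbF.
  have [x xD ax] := exists_inP aD; have [x' xD' ax'] := exists_inP aD'.
  have [y [z [R [E1 d1 u1 [xy yz] m1]]]] := factor_critical_tail (fcS D DS) xD nD.
  have [y' [z' [R' [E2 d2 u2 [xy' yz'] m2]]]] := factor_critical_tail (fcS D' D'S) xD' nD'.
  apply: (tileable_join (p := [:: z; y; x; a; x'; y'; z']) E1 d1 E2 d2 _ _ u1 u2) => //.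
  + by apply: dis => //; move: uD; rewrite inE andbT.
  + move=> t; rewrite !inE => /eqP ->; rewrite negb_or.
    by apply/andP; split; apply: contraTN aS; apply: notS.
  + by apply/permP=> P /=; clear; lia.
  + by rewrite /= (adj_sym z) yz (adj_sym y) xy (adj_sym x) ax ax' xy' yz'.
move=> /and4P [nv nD nD' /and4P [aD av bv bD']] uab uD sS sD.
have aS : a \in S by apply: sS; rewrite !inE eqxx.
have bS : b \in S by apply: sS; rewrite !inE eqxx orbT.
have DS : D \in comps (~: S) by apply: sD; rewrite mem_head.
have vS : v \in comps (~: S) by apply: sD; rewrite !inE eqxx !orbT.
have D'S : D' \in comps (~: S) by apply: sD; rewrite !inE eqxx !orbT.
have [w Ev] : exists w, v = [set w].
  apply/cards1P; rewrite eqn_leq leqNgt nv card_gt0; exact: comps_neq0 vS.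
have [aw bw] : adj a w /\ adj b w.
  by move: av bv; rewrite Ev => /exists_inP [t /set1P ->] at' /exists_inP [t' /set1P ->].
have wS : w \notin S by apply: (notS v); rewrite // Ev set11.
have [vD [vD' DD']] : v != D /\ v != D' /\ D != D'.
  by move: uD; rewrite !inE negb_or andbT ![D == v]eq_sym => /andP [/andP [-> ->] ->].
have -> : covered [:: a; b] [:: D; v; D'] = [set t in [:: a; w; b]] :|: (D :|: D').
  by apply/setP=> t; rewrite Ev !inE /= ?inE orbF; do !case: (_ == _); rewrite ?orbT.
have [x xD ax] := exists_inP aD; have [x' xD' bx'] := exists_inP bD'.
have [y [z [R [E1 d1 u1 [xy yz] m1]]]] := factor_critical_tail (fcS D DS) xD nD.
(* Here [D'] gives up only [x'], and factor-criticality matches the rest of it. *)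
apply: (tileable_join (p := [:: z; y; x; a; w; b; x']) (s2 := [:: x'])
  (R2 := D' :\ x') E1 d1 _ _ _ _ u1) => //.
- by rewrite -{1}(setD1K xD'); congr (_ :|: _); apply/setP=> t; rewrite !inE.
- by apply/pred0P => t; rewrite !inE; case: eqP.
- exact: dis.
- move=> t; rewrite !inE => /or3P [] /eqP ->; rewrite negb_or; apply/andP; split.
  + by apply: contraTN aS; apply: notS.
  + by apply: contraTN aS; apply: notS.
  + by have := dis v D vS DS vD; rewrite Ev disjoints1.
  + by have := dis v D' vS D'S vD'; rewrite Ev disjoints1.
  + by apply: contraTN bS; apply: notS.
  + by apply: contraTN bS; apply: notS.
- rewrite /= !inE negb_or andbT; move: uab; rewrite inE andbT => ->; rewrite andbT.
  by apply/andP; split; [apply: contraTneq aS => -> | apply: contraNneq wS => ->].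
- by apply/permP=> P /=; clear; lia.
- by rewrite /= (adj_sym z) yz (adj_sym y) xy (adj_sym x) ax aw (adj_sym w) bw bx'.
exact: fcS.
Qed.

Lemma tileable_piecewise S (ss : seq (seq G * seq {set G})) :
  (forall C, C \in comps (~: S) -> factor_critical C) ->
  piecewise (@nbr G) nontrivial ss ->
  {subset lefts ss <= S} -> {subset rights ss <= comps (~: S)} ->
  tileable (covered (lefts ss) (rights ss)).
Proof.
move=> fcS; elim: ss => [|p ss IHss].
  move=> _ _ _; rewrite (_ : covered _ _ = set0); first exact: tileable0.
  by apply/setP=> x; rewrite !inE.
rewrite /piecewise /lefts /rights /= !cat_uniq -/(lefts ss) -/(rights ss).
move=> /and3P [/andP [pP ssP] /and3P [u1 d1 ul] /and3P [u2 d2 ur]] sS sD.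
have -> : covered (p.1 ++ lefts ss) (p.2 ++ rights ss) =
    covered p.1 p.2 :|: covered (lefts ss) (rights ss).
  by apply/setP=> x; rewrite !inE mem_cat has_cat orbACA.
apply: tileableU.
- apply/pred0P => x /=; apply/negP; rewrite !inE => /andP [].
  have notS C : C \in p.2 ++ rights ss -> x \in C -> x \notin S.
    by move=> /sD /comps_sub /subsetP sC /sC; rewrite inE.
  case/orP => [xp|/hasP [C Cp xC]] /orP [xs|/hasP [D Ds xD]].
  + by case/hasP: d1; exists x.
  + by have := notS D; rewrite mem_cat Ds orbT xD sS ?mem_cat ?xp // => /(_ isT isT).
  + by have := notS C; rewrite mem_cat Cp xC sS ?mem_cat ?xs ?orbT // => /(_ isT isT).
  + case/hasP: d2; exists D => //=.
    have -> // : D = C; apply: (comps_eq _ _ xD xC); apply: sD; rewrite mem_cat ?Cp ?Ds ?orbT //.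
- apply: (tileable_piece fcS pP u1 u2) => t tp.
    by apply: sS; rewrite mem_cat tp.
  by apply: sD; rewrite mem_cat tp.
apply: IHss => [|t tp|t tp]; first by rewrite /piecewise ssP ul ur.
  by apply: sS; rewrite mem_cat tp orbT.
by apply: sD; rewrite mem_cat tp orbT.
Qed.

End Assembly.

(** * From tilings to factors *)

Lemma uniq_flatten_mem (T : eqType) (ss : seq (seq T)) (s t : seq T) x :
  uniq (flatten ss) -> s \in ss -> t \in ss -> x \in s -> x \in t -> s = t.
Proof.
elim: ss => //= r ss IHss; rewrite cat_uniq => /and3P [_ /hasPn dr uss].
have no q : x \in r -> q \in ss -> x \in q -> False.
  move=> xr qs xq; suff : x \notin r by rewrite xr.
  by apply: dr; apply/flattenP; exists q.
rewrite !inE => /orP [/eqP ->|ss_s] /orP [/eqP ->|ss_t] // xs xt.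
- by case: (no t xs ss_t xt).
- by case: (no s xt ss_s xs).
- exact: IHss.
Qed.

Section Factor.
Variable G : sgraph.
Implicit Types (p : seq G) (ss : seq (seq G)).

Definition consecutive p : rel G := fun x y =>
  [&& x \in p, y \in p &
      ((index x p).+1 == index y p) || ((index y p).+1 == index x p)].

Definition path_union ss : rel G := fun x y => has (fun p => consecutive p x y) ss.

Lemma path_union_sym ss : symmetric (path_union ss).
Proof.
by move=> x y; apply: eq_has => p; rewrite /consecutive andbCA orbC.
Qed.

Lemma path_union_sub ss : all (sorted (@adj G)) ss ->
  subrel (path_union ss) (@adj G).
Proof.
move=> /allP ssP x y /hasP [p /ssP p_adj /and3P [xp yp xy]].
have next u v : u \in p -> v \in p -> (index u p).+1 == index v p -> adj u v.
  move=> up vp /eqP E; rewrite -(nth_index u up) -(nth_index u vp) -E.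
  by apply/sortedP => //; rewrite E index_mem.
by case/orP: xy => /next E; [|rewrite adj_sym]; apply: E.
Qed.

(** The lists of the tiling are disjoint, so an edge of [path_union ss] never leaves its list. The
    component of [x] is thus the list through [x], and [index] is the isomorphism onto
    [path_graph]. *)
Lemma tileable_has_factor : tileable [set: G] ->
  has_factor (fun K => K = path_graph 2 \/ K = path_graph 7) G.
Proof.
case=> ss [ssP uss coverss].
have [/allP ss_size ss_adj] : all (fun p => size p \in [:: 2; 7]) ss /\ all (sorted (@adj G)) ss.
  by split; apply: sub_all ssP => p /andP [].
pose F := SpanningSubgraph (@path_union_sym ss) (path_union_sub ss_adj).
exists F => _ /imsetP [x _ ->].
have [p p_ss xp] : exists2 p, p \in ss & x \in p by apply/flattenP; rewrite coverss inE.
have up : uniq p.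
  by move: uss; rewrite (perm_uniq (perm_flatten (perm_to_rem p_ss))) /= cat_uniq => /and3P [].
have F_p u v : u \in p -> path_union ss u v = consecutive p u v.
  move=> u_p; apply/hasP/idP => [[q q_ss]|uv]; last by exists p.
  by move=> /[dup] /and3P [uq _ _]; rewrite (uniq_flatten_mem uss p_ss q_ss u_p uq).
have connE y : connect (@adj F) x y = (y \in p).
  apply/idP/idP.
    case/connectP=> s; elim: s x xp => [|t s IHs] z zp /=; first by move=> _ ->.
    case/andP; rewrite F_p // => /and3P [_ tp _]; exact: IHs.
  have from0 u : u \in p -> connect (@adj F) (nth x p 0) u.
    move=> u_p; rewrite -(nth_index x u_p); have : index u p < size p by rewrite index_mem.
    elim: (index u p) => [|i IHi] i_lt; first exact: connect0.
    apply: connect_trans (IHi (ltnW i_lt)) _; apply: connect1.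
    have i_lt' := ltnW i_lt.
    by rewrite /= F_p /consecutive !mem_nth //= !index_uniq ?eqxx.
  move=> yp; apply: connect_trans (from0 y yp).
  by rewrite (sym_connect_sym (@adj_sym F)); apply: from0.
exists (path_graph (size p)).
  by have := ss_size p p_ss; rewrite !inE => /orP [] /eqP ->; [left|right].
set C := [set y in _ | _].
have memC y : (y \in C) = (y \in p) by rewrite !inE connE.
have idx_lt (u : induced C) : index (val u) p < size p by rewrite index_mem -memC (valP u).
have nthC (i : 'I_(size p)) : nth x p i \in C by rewrite memC mem_nth.
exists (fun u => Ordinal (idx_lt u)).
  exists (fun i : 'I_(size p) => Sub (nth x p i) (nthC i) : induced C) => [u|i];
    apply: val_inj => /=.
    by rewrite nth_index // -memC (valP u).
  by rewrite index_uniq.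
move=> u v; rewrite /= /path_adj /induced_adj /= F_p /consecutive -!memC ?(valP u) ?(valP v) //.
Qed.

End Factor.

(** * Tiling the whole graph *)

Section Main.
Variable G : sgraph.
Implicit Types (U W C D S X : {set G}) (x y z u v : G) (M : G -> G).

Lemma tileable_setT : (forall X, weight (~: X) <= 2 * #|X|) -> tileable [set: G].
Proof.
move=> hG; have [->|[x0 _]] := set_0Vmem [set: G]; first exact: tileable0.
have [S [m [_ fcS m_inj mP]]] := barrier_exists [set: G].
rewrite setTD in fcS mP.
pose V := [set D in comps (~: S) | #|D| == 1].
pose N := [set D in comps (~: S) | bad D && (#|D| != 1)].
have sVN D : D \in V :|: N -> D \in comps (~: S) by rewrite !inE => /orP [] /andP [].
have badVN D : D \in V :|: N -> bad D.
  rewrite !inE => /orP [/andP [DS D1]|/and3P [] //].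
  by apply: bad_small; [exact: comps_self DS | rewrite (eqP D1) | rewrite (eqP D1)].
have dVN : [disjoint V & N].
  by apply/pred0P=> D /=; rewrite !inE; case: (_ == 1); rewrite ?andbF.
(* The two Boolean tags stand for the two units that each vertex of [S] distributes. *)
pose e (w : {set G} * 'I_3) := setX [set a in S | nbr a w.1] [set: bool].
(* Hall's condition: the units in [B] number at most the total demand of the components in [P],
   which [sum_demand] bounds by twice the number of their neighbours in [S]. *)
have [B sB|g g_inj ge] := @Hall_marriage _ _ (x0, true) e (units V N).
  pose P := [set w.1 | w in B].
  have sP D : D \in P -> D \in V :|: N.
    by case/imsetP=> w /(subsetP sB) + ->; rewrite !inE => /orP [->|/andP [-> _]]; rewrite ?orbT.
  have le1 : #|B| <= \sum_(D in P) demand D.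
    rewrite -sum1_card (partition_big fst (mem P)) /=; last by move=> w; apply: imset_f.
    apply: leq_sum => D DP; rewrite sum1_card /demand; case: ifPn => D1.
      apply: (@leq_trans #|[set (D, i) | i : 'I_3]|).
        apply: subset_leq_card; apply/subsetP=> -[D' i] /andP [_ /eqP /= ->].
        exact: imset_f.
      by apply: leq_trans (leq_imset_card _ _) _; rewrite card_ord.
    apply: (@leq_trans #|[set (D, ord0 : 'I_3)]|); last by rewrite cards1.
    apply: subset_leq_card; apply/subsetP=> -[D' i] /andP [/(subsetP sB) + /eqP /= E].
    by rewrite !inE E /= xpair_eqE eqxx (negPf D1) andbF /= => /andP [].
  apply: leq_trans le1 _; apply: leq_trans (sum_demand (S := S) hG _ _) _.
  - by apply/subsetP => D /sP/sVN.
  - by move=> D /sP/badVN.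
  have <- (Z : {set G}) : #|setX Z [set: bool]| = 2 * #|Z|.
    by rewrite cardsX cardsT card_bool mulnC.
  apply: subset_leq_card.
  apply/subsetP=> -[a b]; rewrite !inE andbT /= => /andP [aS /exists_inP [D /imsetP [w wB ->] aD]].
  by apply/bigcupP; exists w => //; rewrite !inE aS aD.
have [|||ss [ssP ssR ssL]] := pieces_of_units (e := @nbr G) (nt := fun D => 1 < #|D|) dVN g_inj.
- by move=> w /ge; rewrite !inE => /andP [/andP []].
- by move=> D; rewrite inE => /andP [_ /eqP ->].
- move=> D; rewrite inE => /and3P [DS _ D1].
  by rewrite ltn_neqAle eq_sym D1 card_gt0 (comps_neq0 DS).
have [|a aS|tt [ttP ttL ttR ttR']] := augment_pieces ssP _ m_inj.
- by move=> a /ssL /imsetP [w /ge + ->]; rewrite !inE => /andP [/andP []].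
- by have [] := mP a aS.
have ttS D : D \in rights tt -> D \in comps (~: S).
  move=> /ttR' []; first by rewrite ssR; apply: sVN.
  by case/imsetP=> a /mP [mS _] ->.
(* All bad components are in [rights tt], so those in [Rest] are tileable on their own by
   [bad_or_tileable]. *)
pose Rest := [set D in comps (~: S) | D \notin rights tt].
have -> : [set: G] = covered (lefts tt) (rights tt) :|: \bigcup_(D in Rest) D.
  apply/setP=> x; rewrite !inE; apply/esym.
  case: (boolP (x \in S)) => xS; first by rewrite ttL xS.
  have [|D DS xD] := @comps_cover _ (~: S) x; first by rewrite inE.
  case: (boolP (D \in rights tt)) => DR.
    by apply/orP; left; apply/orP; right; apply/hasP; exists D.
  by apply/orP; right; apply/bigcupP; exists D => //; rewrite inE DS.
apply: tileableU.
- apply/pred0P => x /=; apply/negP => /andP [+ /bigcupP [D]].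
  rewrite !inE => xt /andP [DS DR] xD; case/orP: xt => [|/hasP [D' D'R xD']].
    by rewrite ttL => xS; have := subsetP (comps_sub DS) x xD; rewrite inE xS.
  by case/negP: DR; rewrite (comps_eq DS (ttS _ D'R) xD xD').
- by apply: (tileable_piecewise fcS ttP) => [a|]; rewrite ?ttL.
apply: bigcup_disjoint_ind => [|B C|D|D D'].
- exact: tileable0.
- exact: tileableU.
- rewrite inE => /andP [DS DR].
  case: (bad_or_tileable (comps_self DS) (fcS D DS)) => // badD.
  case/negP: DR; apply: ttR; rewrite ssR !inE DS badD /=.
  by case: (_ == 1).
rewrite !inE => /andP [DS _] /andP [D'S _] DD'; apply/pred0P => x /=.
by apply: contraNF DD' => /andP [xD xD']; apply/eqP; apply: (comps_eq DS D'S xD xD').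
Qed.

End Main.

Import GRing.Theory Num.Theory.
Local Open Scope ring_scope.

Theorem theorem1p1 (G : sgraph)
    (hG : forall X : {set G},
       (ncomp 1 (delete X))%:R + 1 / 3 * (ncomp 3 (delete X))%:R
         + 1 / 3 * (ncomp 5 (delete X))%:R <= 2 / 3 * (#|X|)%:R :> rat) :
  has_factor (fun K => K = path_graph 2 \/ K = path_graph 7) G.
Proof.
apply/tileable_has_factor/tileable_setT => X.
(* Three times the rational hypothesis is the integer bound on the weight. *)
apply: leq_trans (weight_delete X) _; rewrite -(ler_nat rat).
by rewrite 2!natrD !natrM; have := hG X; lra.
Qed.
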